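(* Let $K\subseteq[0,1]$ be a compact set and $s\in(1,2]$. Then for every $f\in H_s(K)$ there exists a compact subset $F\subseteq K$ such that (1) $\dim_H F=s-1$, and (2) the restriction $f|_F$ is nearly locally Lipschitz on $F$.
   Context: For $K\subseteq[0,1]$, $C(K)$ is the space of real-valued continuous functions on $K$, $G_f(X)=\{(x,f(x)):x\in X\}$, $\dim_H$ is Hausdorff dimension, and $H_s(K)=\{f\in C(K):\dim_H G_f(K)=s\}$. A function $f\in C(K)$ is called nearly locally Lipschitz on $K$ if for all but countably many points $x\in K$ there is $r_x>0$ such that $f$ is Lipschitz on $K\cap B(x,r_x)$, where $B(x,r)$ is the open ball of center $x$ and radius $r$. *)

(* Defs.v *)
From HB Require Import structures.
From mathcomp Require Import all_boot all_order all_algebra.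
From mathcomp Require Import all_classical all_reals all_analysis.
Set Implicit Arguments. Unset Strict Implicit. Unset Printing Implicit Defensive.
Import Order.TTheory GRing.Theory Num.Theory.
Import numFieldNormedType.Exports.
Local Open Scope classical_set_scope.
Local Open Scope ring_scope.

Section Hausdorff.
Variables (R : realType) (T : Type) (d : T -> T -> R).

Definition diam (A : set T) : \bar R :=
  if pselect (A = set0) then 0%E
  else ereal_sup [set (d x y)%:E | x in A & y in A].

Definition diam_pow (s : R) (U : set T) : \bar R :=
  if pselect (U = set0) then 0%E else ((fine (diam U)) `^ s)%:E.

Definition hcontent (s delta : R) (A : set T) : \bar R :=
  ereal_inf [set (\sum_(0 <= n <oo) diam_pow s (U n))%E |
     U in [set U : nat -> set T |
       A `<=` \bigcup_n U n /\ forall n, (diam (U n) <= delta%:E)%E]].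

(* s-dimensional Hausdorff measure H^s(A) = lim_{delta -> 0+} = sup_{delta>0} *)
Definition hmeasure (s : R) (A : set T) : \bar R :=
  ereal_sup [set hcontent s delta A | delta in [set delta : R | 0 < delta]].

Definition hdim (A : set T) : \bar R :=
  ereal_inf [set s%:E | s in [set s : R | 0 <= s /\ hmeasure s A = 0%E]].

End Hausdorff.

Definition dist1 (R : realType) (x y : R) : R := `|x - y|.
Definition dist2 (R : realType) (p q : R * R) : R :=
  Num.sqrt ((p.1 - q.1) ^+ 2 + (p.2 - q.2) ^+ 2).

Definition hdim1 (R : realType) (A : set R) := hdim (@dist1 R) A.
Definition hdim2 (R : realType) (A : set (R * R)) := hdim (@dist2 R) A.

Definition graph (R : realType) (f : R -> R) (X : set R) : set (R * R) :=
  [set (x, f x) | x in X].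

Definition nearly_locally_lipschitz (R : realType) (K : set R) (f : R -> R) :=
  exists C : set R, countable C /\
    forall x, K x -> ~ C x ->
      exists2 r : R, 0 < r &
        exists L : R, forall y z, K y -> K z -> `|x - y| < r -> `|x - z| < r ->
          `|f y - f z| <= L * `|y - z|.

(* Main.v *)
(* If [1 < t < t' < s], the part of the graph of [f] over any neighbourhood of a
   suitable point [x0] of [K] has dimension larger than [t'], so at every scale
   [2^-n] it carries a finite Frostman measure. Averaging over a finite grid of
   lines [y = m x + b] as in Marstrand's slicing theorem, some line satisfies
   [mass - lam * energy - cost >= c], where [cost] sums [rho ^ (v - 1)] over the
   squares of efficient covers of the graph, of exponents [v] decreasing to [s],
   that the line meets. A cluster point of these lines as [n] grows gives a slice
   [{x | f x = m x + b}] on which [f] is affine, whose dimension is at least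
   [t - 1] (energy) and at most [s - 1] (cost). Taking such slices with [t] tending
   to [s] over disjoint annuli shrinking to [x0], and adding [x0], gives [F]. *)
Require Import Defs.
From HB Require Import structures.
From mathcomp Require Import all_boot all_order all_algebra.
From mathcomp Require Import all_classical all_reals all_analysis.
From mathcomp Require Import ring lra.
Import Order.TTheory GRing.Theory Num.Theory.
Import numFieldNormedType.Exports.
Local Open Scope classical_set_scope.
Local Open Scope ring_scope.

(** * Measures of finite energy on finite metric spaces *)

(** Slicing usually relies on Radon measures, weak limits and measurable families of lines. Here
    every scale is a finite sum, and the only limit is taken among pairs [(m, b)] in a compact
    rectangle. The obstacle is that only inequalities about finite lists of balls survive this
    limit, so both dimension bounds are put in that form: large capacity becomes a lower bound on
    the cost of every cover of a thin strip around the line, and smallness becomes a bound on the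
    cost of finite covers fixed in advance. Both bounds must hold for the same line, which is why
    mass, energy and cost enter one averaged inequality. The exponent drops by one on both sides by
    counting: a square of radius [rho] meets a proportion of order [rho] of the lines, while two
    points at distance [k] share a number of lines of order [1 / k]. Slopes stay in [0, 1], so no
    line is vertical and horizontal intervals alone control distances inside a slice. Non-nullity of
    the graph is known only below the exponent [s], so one slice does not suffice; infinitely many
    must accumulate, and [x0] is the one exceptional point this costs. *)

Lemma greedy_weights (R : realType) (I J : finType) (B : J -> pred I)
    (cap : J -> R) (s : seq I) :
  (forall j, 0 <= cap j) -> (forall i, i \in s -> exists j, B j i) ->
  exists mu : I -> R, [/\ forall i, 0 <= mu i,
    forall j, \sum_(i | B j i) mu i <= cap j &
    forall i, i \in s -> exists2 j, B j i & \sum_(i | B j i) mu i = cap j].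
Proof.
move=> cap0; elim: s => [_|k s IH sB].
  by exists (fun=> 0); split => // j; rewrite big1.
have [|mu [mu0 muB mus]] := IH; first by move=> i si; apply: sB; rewrite inE si orbT.
have [j0 Bj0] : exists j, B j k by apply: sB; rewrite inE eqxx.
pose sl j := cap j - \sum_(i | B j i) mu i.
have [j1 Bj1 j1P] : exists2 j1, B j1 k & forall j, B j k -> sl j1 <= sl j.
  by case: (@arg_minP _ _ _ j0 (fun j => B j k) sl Bj0) => j1; exists j1.
have sl0 j : 0 <= sl j by rewrite subr_ge0.
(* The point [k] receives the least slack among the sets containing it: no cap is exceeded, the
   minimizing set becomes tight, and tight sets stay tight because weights only grow. *)
pose mu' i := mu i + (if i == k then sl j1 else 0).
have mu'E j : \sum_(i | B j i) mu' i =
    \sum_(i | B j i) mu i + (if B j k then sl j1 else 0).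
  rewrite big_split /=; congr (_ + _); rewrite -big_mkcondr/=.
  case: ifPn => Bjk.
    rewrite (big_pred1 k)// => i; rewrite /= andbC.
    by case: (eqVneq i k) => //= ->.
  by rewrite big_pred0// => i; case: (eqVneq i k) => [->|_]; rewrite ?andbF// (negbTE Bjk).
have mu'cap j : \sum_(i | B j i) mu' i <= cap j.
  rewrite mu'E; case: ifPn => [/j1P|_]; last by rewrite addr0; exact: muB.
  by rewrite /sl; lra.
exists mu'; split => //.
- by move=> i; rewrite addr_ge0//; case: ifP.
- move=> i; rewrite inE => /predU1P[->|/mus[j Bji muj]].
    by exists j1 => //; rewrite mu'E Bj1 /sl addrC subrK.
  exists j => //; apply/eqP; rewrite eq_le mu'cap/= mu'E muj lerDl.
  by case: ifP.
Qed.

(** Keep a pair of least level, hence of largest radius, discard every ball too close to it, and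
    recurse on the rest. A centre distance above the sum of the radii expresses disjointness. *)
Lemma finite_vitali (R : realType) (I : finType) (D : I -> I -> R) (n : nat)
    (T : {set I * 'I_n}) (rad : 'I_n -> R) :
  (forall i j, D i j = D j i) ->
  (forall l l' : 'I_n, (l <= l')%N -> rad l' <= rad l) ->
  exists2 S : {set I * 'I_n}, S \subset T &
    (forall p q, p \in S -> q \in S -> p != q ->
       rad p.2 + rad q.2 < D p.1 q.1) /\
    (forall q, q \in T -> exists2 p, p \in S &
       (p.2 <= q.2)%N /\ (p = q \/ D p.1 q.1 <= rad p.2 + rad q.2)).
Proof.
move=> Dsym rad_le.
have [k] := ubnP #|T|; elim: k T => // k IH T Tk.
have [->|/finset.set0Pn[p0 p0T]] := eqVneq T finset.set0.
  by exists finset.set0; [exact: finset.sub0set|split => ?; rewrite inE].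
have [p pT pmin] : exists2 p, p \in T & forall q, q \in T -> (p.2 <= q.2)%N.
  by case: (@arg_minnP _ p0 (fun p => p \in T) (fun p => p.2 : nat) p0T) => p; exists p.
pose far q := rad p.2 + rad q.2 < D p.1 q.1.
pose T' := [set q in T | (q != p) && far q]%SET.
have [|S ST' [Sd Sc]] := IH T'.
  rewrite -ltnS (leq_trans _ Tk)// ltnS; apply: proper_card; apply/properP; split.
    by apply/fintype.subsetP => q; rewrite inE => /andP[].
  by exists p => //; rewrite inE eqxx andbF.
have ST q : q \in S -> [/\ q \in T, q != p & far q].
  by move/(fintype.subsetP ST'); rewrite inE => /and3P[].
exists (p |: S)%SET.
  by apply/fintype.subsetP => q; rewrite !inE => /predU1P[->//|/ST[]].
split=> [q q'|q qT].
  rewrite !inE => /predU1P[->|qS] /predU1P[->|q'S]; first by rewrite eqxx.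
  - by move=> _; have [] := ST _ q'S.
  - by move=> _; rewrite addrC Dsym; have [] := ST _ qS.
  - exact: Sd.
have [->|qp] := eqVneq q p; first by exists p; [rewrite !inE eqxx|split => //; left].
have [qf|qn] := boolP (far q).
  have [|p' p'S [? ?]] := Sc q; first by rewrite inE qT qp.
  by exists p'; rewrite // !inE p'S orbT.
exists p; first by rewrite !inE eqxx.
by split; [exact: pmin|right; rewrite leNgt].
Qed.

(* Frostman's lemma: a maximal measure saturates a ball around every point, and
   disjoint saturated balls selected as in Vitali's lemma bound its mass below. *)
Lemma finite_frostman (R : realType) (I : finType) (D : I -> I -> R)
    (a t : R) (n : nat) :
  0 <= a <= 1 -> 0 <= t ->
  (forall i, D i i = 0) -> (forall i j, D i j = D j i) ->
  (forall i j k, D i k <= D i j + D j k) ->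
  exists mu : I -> R, [/\ forall i, 0 <= mu i,
    forall i (l : 'I_n.+1), \sum_(j | D i j <= a ^+ l) mu j <= (a ^+ l) `^ t &
    exists2 S : {set I * 'I_n.+1},
      forall k, exists2 p, p \in S & D p.1 k <= a ^+ p.2 *+ 3 &
      \sum_(p in S) (a ^+ p.2) `^ t <= \sum_i mu i].
Proof.
move=> /andP[a0 a1] t0 D0 Dsym Dtri.
pose B (p : I * 'I_n.+1) : pred I := fun j => D p.1 j <= a ^+ p.2.
have [||mu [mu0 muB mutight]] :=
    @greedy_weights R _ _ B (fun p => (a ^+ p.2) `^ t) (enum I).
- by move=> p; exact: powR_ge0.
- by move=> i _; exists (i, ord0); rewrite /B/= D0 expr0.
exists mu; split => //; first by move=> i l; exact: (muB (i, l)).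
have rad_le (l l' : 'I_n.+1) : (l <= l')%N -> a ^+ l' <= a ^+ l.
  by move=> ll'; rewrite ler_wiXn2l.
pose T := [set p : I * 'I_n.+1 | \sum_(i | B p i) mu i == (a ^+ p.2) `^ t]%SET.
have [S /fintype.subsetP ST [Sd Sc]] := @finite_vitali R I D n.+1 T (fun l => a ^+ l) Dsym rad_le.
exists S.
  move=> k; have [|p Bpk pt] := mutight k; first by rewrite mem_enum.
  have [|q qS [qp]] := Sc p; first by rewrite inE pt.
  have pq := rad_le _ _ qp.
  case=> [qep|].
    exists q; rewrite // qep (le_trans Bpk)// mulrS lerDl mulrn_wge0//.
    by rewrite exprn_ge0.
  (* The tight ball [p] around [k] is close to a selected ball [q] of at least its radius: one
     radius of [q] and two of [p] give the factor 3. *)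
  move=> Dqp; exists q => //.
  apply: le_trans (Dtri _ p.1 _) _; rewrite !mulrS mulr0n.
  have := Bpk; rewrite /B; lra.
have -> : \sum_(p in S) (a ^+ p.2) `^ t = \sum_(p in S) \sum_(i | B p i) mu i.
  by apply: eq_bigr => p /ST; rewrite inE => /eqP.
rewrite (exchange_big_dep predT)//=; apply: ler_sum => i _.
case: (pickP (fun p => (p \in S) && B p i)) => [p /andP[pS Bpi]|none]; last first.
  by rewrite big_pred0.
rewrite (bigD1 p) ?pS//= big1 ?addr0// => q /andP[/andP[qS Bqi] qp].
have := Sd _ _ qS pS qp; rewrite ltNge => /negP[].
by apply: le_trans (Dtri _ i _) _; rewrite lerD// Dsym.
Qed.

(** One term suffices: at the last scale [a ^+ l >= d] with [l <= n], the truncated distance is at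
    least [a ^+ l.+1]. Energies thereby become sums of masses of balls. *)
Lemma truncated_kernel_le (R : realType) (a t d : R) (n : nat) :
  0 < a < 1 -> 0 <= t -> d <= 1 ->
  (Num.max d (a ^+ n)) `^ (- t) <=
    \sum_(l < n.+1 | d <= a ^+ l) (a ^+ l.+1) `^ (- t).
Proof.
move=> /andP[a0 a1] t0 d1.
have anti x y : 0 < x -> x <= y -> y `^ (- t) <= x `^ (- t).
  move=> x0 xy; have y0 := lt_le_trans x0 xy.
  by rewrite !powRN lef_pV2 ?posrE ?powR_gt0// ge0_ler_powR// nnegrE ltW.
have ap k : 0 < a ^+ k by exact: exprn_gt0.
have aS k : a ^+ k.+1 <= a ^+ k by rewrite ler_wiXn2l// ltW.
elim: n => [|n IH].
  rewrite big_mkcond big_ord_recl big_ord0 /= expr0 d1 addr0 (max_idPr d1).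
  by apply: anti => //; exact: ltW.
rewrite big_mkcond big_ord_recr/= -big_mkcond.
have S0 : 0 <= \sum_(i < n.+1 | d <= a ^+ i) (a ^+ i.+1) `^ (- t).
  by apply: sumr_ge0 => i _; exact: powR_ge0.
case: ifPn => [dn|].
  rewrite (max_idPr dn); apply: le_trans (anti _ _ _ (aS n.+1)) _ => //.
  by rewrite lerDr.
rewrite -ltNge addr0 => nd; rewrite (max_idPl (ltW nd)).
have [dn|dn] := leP (a ^+ n) d; first by rewrite (max_idPl dn) in IH.
rewrite (bigD1 ord_max)//=; last exact: ltW.
apply: ler_wpDr; first by apply: sumr_ge0 => i _; exact: powR_ge0.
by apply: anti => //; exact: ltW.
Qed.

(** Masses of exponent [t'] against a kernel of exponent [t] give a geometric series of ratio [2^-1]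
    to the power [t' - t]. That [C] depends neither on [I] nor on [n] is what allows the scale to
    shrink. *)
Lemma energy_bound (R : realType) (t t' : R) : 0 <= t -> t < t' ->
  exists2 C : R, 0 < C & forall (I : finType) (mu : I -> R) (d : I -> R) (n : nat),
    (forall i, 0 <= mu i) -> (forall i, d i <= 1) ->
    (forall l : 'I_n.+1, \sum_(j | d j <= 2^-1 ^+ l) mu j <= (2^-1 ^+ l) `^ t') ->
    \sum_j mu j * (Num.max (d j) (2^-1 ^+ n)) `^ (- t) <= C.
Proof.
move=> t0 tt'; set a : R := 2^-1.
have a0 : 0 < a by rewrite /a invr_gt0.
have a1 : a < 1 by rewrite /a invf_lt1// ltr1n.
pose q := a `^ (t' - t).
have q0 : 0 < q by exact: powR_gt0.
have q1 : q < 1.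
  have := @gt0_ltr_powR R (t' - t) _ a 1; rewrite powR1; apply => //.
  - by rewrite subr_gt0.
  - by rewrite nnegrE ltW.
  - by rewrite nnegrE ler01.
exists (a `^ (- t) / (1 - q)); first by rewrite divr_gt0 ?powR_gt0// subr_gt0.
move=> I mu d n mu0 d1 muB.
apply: (@le_trans _ _ (\sum_j mu j *
    \sum_(l < n.+1 | d j <= a ^+ l) (a ^+ l.+1) `^ (- t))).
  apply: ler_sum => j _; apply: ler_wpM2l => //.
  by apply: truncated_kernel_le; rewrite ?a0.
under eq_bigr do rewrite mulr_sumr.
rewrite (exchange_big_dep predT)//=.
apply: (@le_trans _ _ (\sum_(l < n.+1) a `^ (- t) * q ^+ l)).
  apply: ler_sum => l _; rewrite -mulr_suml.
  apply: le_trans (ler_wpM2r (powR_ge0 _ _) (muB l)) _.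
  rewrite -!powR_mulrn; try exact: ltW.
  rewrite -!powRrM -!powRD; last first.
  - by apply/implyP => _; rewrite gt_eqF.
  - by apply/implyP => _; rewrite gt_eqF.
  by rewrite (_ : _ + _ = - t + (t' - t) * l%:R)// -natr1; ring.
rewrite -mulr_sumr; apply: ler_wpM2l; first exact: powR_ge0.
have := subrX1 q n.+1; rewrite -subr_gt0 in q1.
have := exprn_ge0 n.+1 (ltW q0); set S := \sum_(i < _) _ => qn SE.
by rewrite -[leRHS]mul1r ler_pdivlMr//; nra.
Qed.

(* A set carrying a measure of finite energy has positive capacity: on each
   piece [a - lam a^2 / kap <= kap / (4 lam)]. *)
Lemma capacity_bound (R : realType) (I : finType) (Q : eqType) (L : seq Q)
    (B : Q -> pred I) (kap : Q -> R) (w : I -> R) (k : I -> I -> R) (lam : R) :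
  0 < lam -> (forall q, q \in L -> 0 < kap q) -> (forall i, 0 <= w i) ->
  (forall i j, 0 <= k i j) ->
  (forall i, w i != 0 -> exists2 q, q \in L & B q i) ->
  (forall q i j, q \in L -> B q i -> B q j -> w i != 0 -> w j != 0 ->
     (kap q)^-1 <= k i j) ->
  \sum_i w i - lam * \sum_i \sum_j w i * w j * k i j <=
  \sum_(q <- L) kap q / (4 * lam).
Proof.
move=> lam0; elim: L w => [w _ w0 k0 wB _|q L IH w kap0 w0 k0 wB wk].
  have {}w0 i : w i = 0.
    by apply/eqP/negP => /negP /wB[].
  rewrite big_nil !big1 ?mulr0 ?subrr// => i _.
  by rewrite big1// => j _; rewrite !w0 !mul0r.
pose w1 i := if B q i then w i else 0.
pose w2 i := if B q i then 0 else w i.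
have w10 i : 0 <= w1 i by rewrite /w1; case: ifP.
have w20 i : 0 <= w2 i by rewrite /w2; case: ifP.
have wE i : w i = w1 i + w2 i by rewrite /w1 /w2; case: ifP; rewrite ?addr0 ?add0r.
have IHw : \sum_i w2 i - lam * \sum_i \sum_j w2 i * w2 j * k i j <=
  \sum_(q <- L) kap q / (4 * lam).
  apply: IH => //.
  - by move=> p pL; apply: kap0; rewrite inE pL orbT.
  - move=> i; rewrite /w2; case: ifPn => [_|nB /wB[p]]; first by rewrite eqxx.
    by rewrite inE => /predU1P[->|pL] Bp; [rewrite Bp in nB|exists p].
  - move=> p i j pL Bi Bj; rewrite /w2; case: ifP => _; first by rewrite eqxx.
    by case: ifP => _ wi; rewrite ?eqxx// => wj; apply: (wk p); rewrite // inE pL orbT.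
have kq := kap0 q (mem_head _ _).
have E1 : (\sum_i w1 i) ^+ 2 / kap q <= \sum_i \sum_j w1 i * w1 j * k i j.
  rewrite expr2 mulr_suml mulr_suml; apply: ler_sum => i _.
  rewrite mulr_sumr mulr_suml; apply: ler_sum => j _.
  have [->|wi] := eqVneq (w1 i) 0; first by rewrite !mul0r.
  have [->|wj] := eqVneq (w1 j) 0; first by rewrite mulr0 !mul0r.
  apply: ler_wpM2l; first exact: mulr_ge0.
  move: wi wj; rewrite /w1; case: ifP => Bi; rewrite ?eqxx//.
  by case: ifP => Bj; rewrite ?eqxx// => wi wj; apply: (wk q); rewrite // mem_head.
have E2 : \sum_i \sum_j w1 i * w1 j * k i j + \sum_i \sum_j w2 i * w2 j * k i j
    <= \sum_i \sum_j w i * w j * k i j.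
  rewrite -big_split; apply: ler_sum => i _; rewrite -big_split.
  apply: ler_sum => j _ /=; rewrite -mulrDl; apply: ler_wpM2r => //.
  by rewrite !wE mulrDl !mulrDr -!addrA lerD2l addrA lerDr addr_ge0// mulr_ge0.
rewrite big_cons (eq_bigr (fun i => w1 i + w2 i))// big_split/=.
have : \sum_i w1 i - lam * ((\sum_i w1 i) ^+ 2 / kap q) <= kap q / (4 * lam).
  rewrite -subr_ge0; set a := \sum_i _.
  rewrite (_ : _ - _ = (kap q - a *+ 2 * lam) ^+ 2 / (4 * lam * kap q)).
    by rewrite divr_ge0 ?sqr_ge0// !mulr_ge0// ltW.
  by field; rewrite ?gt_eqF.
have := ler_wpM2l (ltW lam0) E1; have := ler_wpM2l (ltW lam0) E2.
rewrite mulrDr; move: IHw.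
set X := _ * _; set Y := \sum_(i <- _) _; lra.
Qed.

Lemma card_near_le (R : realType) (M : nat) (Y rho : R) : 0 <= rho ->
  (#|[pred b : 'I_M | `|b%:R - Y| <= rho]|)%:R <= 2 * rho + 1.
Proof.
move=> rho0; set P := [pred b | _].
have [->|/card_gt0P[b0 b0P]] := posnP #|P|; first by rewrite ler_wpDl// mulr_ge0.
have [b1 b1P b1min] := arg_minnP (fun b : 'I_M => b : nat) b0P.
have [b2 b2P b2max] := arg_maxnP (fun b : 'I_M => b : nat) b0P.
have bb : (b1 <= b2)%N := b1min _ b2P.
have : (#|P| <= b2 - b1 + 1)%N.
  rewrite addn1 -[X in (_ <= X)%N]card_ord.
  pose g (b : 'I_M) : 'I_(b2 - b1).+1 := inord (b - b1).
  rewrite -(@card_in_image _ _ g); first exact: max_card.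
  move=> x y xP yP /(congr1 val); rewrite /g/= !inordK; last 2 first.
  - by rewrite ltnS leq_sub2r//; exact: b2max.
  - by rewrite ltnS leq_sub2r//; exact: b2max.
  move=> /eqP; rewrite -(eqn_add2r b1) !subnK ?b1min// => /eqP xy.
  exact: val_inj.
rewrite -(ler_nat R) natrD natrB//.
have : b1 \in P by []; have : b2 \in P by [].
rewrite !inE !ler_norml; lra.
Qed.

(** * Counting lines *)

Section Lines.
Context {R : realType}.
Implicit Types (N : nat) (x y rho : R).

(* The lines [y = m x + c] with slopes [a / N] in [0, 1) and intercepts
   [y0 - 2 + b / N] in [y0 - 2, y0 + 2). *)
Definition slope N (o : 'I_N * 'I_(4 * N)) : R := o.1%:R / N%:R.
Definition intercept N y0 (o : 'I_N * 'I_(4 * N)) : R := y0 - 2 + o.2%:R / N%:R.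
Definition gap N y0 (o : 'I_N * 'I_(4 * N)) x y : R :=
  `|y - slope N o * x - intercept N y0 o|.

(** After scaling by [N], counting lines of a given slope near a point amounts to counting integers
    near a real number. *)
Lemma gapE N y0 o x y : (0 < N)%N ->
  gap N y0 o x y * N%:R = `|o.2%:R - (N%:R * (y - y0 + 2) - o.1%:R * x)|.
Proof.
move=> N0; have N0' : N%:R != 0 :> R by rewrite pnatr_eq0 -lt0n.
rewrite /gap -[X in _ * X](ger0_norm (ler0n R N)) -normrM distrC; congr `|_|.
by rewrite /slope /intercept; field.
Qed.

(** Here [y - m x] lies between [y0 - 3/2] and [y0 + 1/2], well inside the range of the intercepts,
    whose spacing is [1 / N]. *)
Lemma exists_line N y0 (a : 'I_N) x y : 0 <= x <= 1 -> `|y - y0| <= 2^-1 ->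
  exists b : 'I_(4 * N), gap N y0 (a, b) x y <= N%:R^-1.
Proof.
move=> /andP[x0 x1]; rewrite ler_norml => /andP[y1 y2].
have N0 : (0 < N)%N by case: N a => [[]|].
have N0' : 0 < N%:R :> R by rewrite ltr0n.
have aN : a%:R <= N%:R :> R by rewrite ler_nat ltnW.
have a0 : 0 <= a%:R :> R by [].
pose Y := N%:R * (y - y0 + 2) - a%:R * x.
have Y0 : 0 <= Y.
  by rewrite /Y subr_ge0; apply: ler_pM => //; lra.
have /andP[tY Yt] := truncn_itv Y0.
have ltb : (Num.truncn Y < 4 * N)%N.
  rewrite -(ltr_nat R) natrM (le_lt_trans tY)// /Y.
  have : 0 <= a%:R * x by exact: mulr_ge0.
  have : N%:R * (y - y0) <= N%:R * 2^-1 by rewrite ler_pM2l.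
  rewrite mulrDr; lra.
exists (Ordinal ltb).
rewrite -[leRHS]mul1r ler_pdivlMr// gapE//= -/Y ler_norml.
rewrite -natr1 in Yt; lra.
Qed.

Lemma sum_near_le (M : nat) (Y rho : R) : 0 <= rho ->
  \sum_(b < M) (`|b%:R - Y| <= rho)%R%:R <= 2 * rho + 1 :> R.
Proof.
move=> rho0; apply: le_trans (card_near_le R M Y rho rho0).
rewrite -sum1_card natr_sum [leRHS]big_mkcond/=; apply: ler_sum => b _.
by rewrite inE; case: ifP.
Qed.

Lemma sum_gap_ge N y0 x y : 0 <= x <= 1 -> `|y - y0| <= 2^-1 ->
  N%:R <= \sum_o (gap N y0 o x y <= N%:R^-1)%R%:R :> R.
Proof.
move=> x01 yy0.
rewrite -(pair_bigA _ (fun a b => (gap N y0 (a, b) x y <= N%:R^-1)%R%:R))/=.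
apply: (@le_trans _ _ (\sum_(a < N) 1)); first by rewrite sumr_const card_ord.
apply: ler_sum => a _; have [b hb] := exists_line N y0 a x y x01 yy0.
by rewrite (bigD1 b)//= hb lerDl sumr_ge0.
Qed.

(** Each of the [N] slopes admits at most [6 * rho * N + 1] intercepts, and the 1 is absorbed
    because [rho * N >= 1]. *)
Lemma sum_gap_le N y0 x y rho : (0 < N)%N -> N%:R^-1 <= rho ->
  \sum_o (gap N y0 o x y < 3 * rho)%R%:R <= 7 * rho * N%:R ^+ 2 :> R.
Proof.
move=> N0 rhoN; have N0' : 0 < N%:R :> R by rewrite ltr0n.
have rN : 1 <= rho * N%:R by rewrite -ler_pdivrMr// mul1r.
have rho0 : 0 < rho by apply: lt_le_trans rhoN; rewrite invr_gt0.
rewrite -(pair_bigA _ (fun a b => (gap N y0 (a, b) x y < 3 * rho)%R%:R))/=.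
apply: (@le_trans _ _ (\sum_(a < N) (7 * rho * N%:R))); last first.
  by rewrite sumr_const card_ord -[_ *+ N]mulr_natr expr2 mulrA.
apply: ler_sum => a _.
apply: (@le_trans _ _ (2 * (3 * rho * N%:R) + 1)); last by lra.
apply: le_trans (sum_near_le (4 * N) (N%:R * (y - y0 + 2) - a%:R * x) _ _); last first.
  by rewrite !mulr_ge0// ltW.
apply: ler_sum => b _; case: ltP => //= h.
by rewrite [X in nat_of_bool X](_ : _ = true)// -(gapE N y0 (a, b))// ler_pM2r// ltW.
Qed.

(** Transversality. A slope [a / N] with a line near both points satisfies [|N dy - a dx| <= 2], and
    then at most 3 intercepts fit. If [|dx|] is at least half the distance [D], at most
    [4 / |dx| + 1 <= 9 / D] slopes qualify. If it is smaller, then [|dy| = D] and slopes below 1 are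
    too flat once [D * N > 8]. For [D * N <= 8] the trivial count of [N] slopes is enough. *)
Lemma sum_gap2_le N y0 x y x' y' : (0 < N)%N ->
  `|x - x'| <= 1 -> `|y - y'| <= 1 ->
  \sum_o (gap N y0 o x y <= N%:R^-1)%R%:R * (gap N y0 o x' y' <= N%:R^-1)%R%:R
    <= 27 / Num.max (Num.max `|x - x'| `|y - y'|) N%:R^-1 :> R.
Proof.
move=> N0 dx1 dy1; have N0' : 0 < N%:R :> R by rewrite ltr0n.
set h := fun o : 'I_N * 'I_(4 * N) => (gap N y0 o x y <= N%:R^-1)%R%:R : R.
set h' := fun o : 'I_N * 'I_(4 * N) => (gap N y0 o x' y' <= N%:R^-1)%R%:R : R.
rewrite -(pair_bigA _ (fun a b => h (a, b) * h' (a, b)))/=.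
set dx := x - x' in dx1 *; set dy := y - y' in dy1 *.
have gapN a b z w : gap N y0 (a, b) z w <= N%:R^-1 ->
    `|b%:R - (N%:R * (w - y0 + 2) - a%:R * z)| <= 1.
  by move=> hg; rewrite -(gapE N y0 (a, b))// -ler_pdivlMr// mul1r.
have hb (a : 'I_N) : \sum_b h (a, b) * h' (a, b) <=
    3 * (`|N%:R * dy - a%:R * dx| <= 2)%R%:R.
  have [near|far] := boolP (`|N%:R * dy - a%:R * dx| <= 2).
    rewrite mulr1; apply: le_trans (_ : 2 * 1 + 1 <= _); last by lra.
    apply: le_trans (sum_near_le (4 * N) (N%:R * (y - y0 + 2) - a%:R * x) 1 ler01).
    apply: ler_sum => b _; rewrite /h /h'.
    case: (boolP (gap N y0 (a, b) x y <= _)) => [/gapN -> |_]; last by rewrite mul0r.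
    by case: (gap _ _ _ x' y' <= _)%R; rewrite ?mulr1 ?mulr0.
  rewrite mulr0 big1// => b _; rewrite /h /h'.
  case: (boolP (gap _ _ _ x y <= _)) => [/gapN h1|_]; last by rewrite mul0r.
  case: (boolP (gap _ _ _ x' y' <= _)) => [/gapN h2|_]; last by rewrite mulr0.
  exfalso; move/negP: far; apply; move: h1 h2; rewrite !ler_norml /dx /dy; lra.
apply: le_trans (ler_sum _ (fun a _ => hb a)) _; rewrite -mulr_sumr.
rewrite (_ : 27 / _ = 3 * (9 / Num.max (Num.max `|dx| `|dy|) N%:R^-1)); last by ring.
rewrite ler_pM2l//; set D := Num.max `|dx| `|dy|.
have D1 : D <= 1 by rewrite /D ge_max dx1.
have dxD : `|dx| <= D by rewrite /D le_max lexx.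
have dyD : `|dy| <= D by rewrite /D le_max lexx orbT.
have [Dsmall|Dlarge] := leP D (8 / N%:R).
  apply: (@le_trans _ _ N%:R).
    rewrite -[leRHS](@mulr1n R) -mulr_natr.
    apply: (@le_trans _ _ (\sum_(a < N) 1)); last by rewrite sumr_const card_ord mul1r.
    by apply: ler_sum => a _; case: (_ <= 2)%R.
  have m0 : 0 < Num.max D N%:R^-1 by rewrite lt_max invr_gt0 N0' orbT.
  rewrite ler_pdivlMr// -ler_pdivlMl// mulrC ge_max.
  rewrite (le_trans Dsmall) ?ler_pM2r ?invr_gt0//=; last by lra.
  by rewrite -[leLHS]mul1r ler_pM2r ?invr_gt0//; lra.
have D0 : 0 < D by apply: lt_trans Dlarge; rewrite divr_gt0.
have DN : 8 < D * N%:R by rewrite -ltr_pdivrMr.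
rewrite max_l; last first.
  by apply/ltW/(le_lt_trans _ Dlarge); rewrite -[leLHS]mul1r ler_pM2r ?invr_gt0//; lra.
have [dxs|dxl] := ltP `|dx| (D / 2).
  have dyE : `|dy| = D.
    rewrite /D; case: (leP `|dx| `|dy|) => // xy.
    by exfalso; move: dxs; rewrite /D max_l ?ltW//; have := normr_ge0 dx; lra.
  rewrite big1 ?divr_ge0// ?ltW// => a _.
  case: (boolP (_ <= 2)) => // h2; exfalso.
  have : `|N%:R * dy| - `|a%:R * dx| <= 2 by apply: le_trans (lerB_dist _ _) h2.
  rewrite !normrM !normr_nat dyE.
  have : a%:R * `|dx| <= N%:R * (D / 2).
    by apply: ler_pM => //; rewrite ?ler_nat ?(ltnW (ltn_ord _))// ltW.
  lra.
have dx0 : 0 < `|dx| by apply: lt_le_trans dxl; rewrite divr_gt0.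
have dxn0 : dx != 0 by rewrite -normr_gt0.
apply: (@le_trans _ _ (2 * (2 / `|dx|) + 1)).
  apply: le_trans (sum_near_le N (N%:R * dy / dx) _ _); last by rewrite divr_ge0.
  apply: ler_sum => a _; case: (boolP (_ <= 2)) => // h2.
  rewrite (_ : (_ <= _) = true)//; rewrite ler_pdivlMr// -normrM mulrBl mulfVK//.
  by rewrite distrC h2 lexx.
rewrite ler_pdivlMr// mulrDl mul1r.
have : 2 / `|dx| * D <= 4.
  by rewrite mulrAC ler_pdivrMr//; lra.
lra.
Qed.

(** Sum over the [4 * N ^ 2] lines, with [T] the total of [mu]. The factor [N] in [w] makes the
    total mass at least [N ^ 2 * T]. The count of common lines contributes [27 / k], which turns the
    exponent [u] into [u + 1], so with 54 = 2 * 27 the energy term takes at most half of the mass.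
    At least [8 * c * N ^ 2] is left, [G] takes at most half of that, and the average is at least
    [c]. *)
Lemma exists_good_line (I : finType) N y0 (x y mu : I -> R) (u Ce c : R)
    (G : 'I_N * 'I_(4 * N) -> R) :
  let k i j := Num.max (Num.max `|x i - x j| `|y i - y j|) N%:R^-1 in
  (0 < N)%N -> 0 < Ce -> (forall i, 0 <= mu i) ->
  (forall i, 0 <= x i <= 1) -> (forall i, `|y i - y0| <= 2^-1) ->
  (forall i, \sum_j mu j * k i j `^ (- (u + 1)) <= Ce) ->
  16 * c <= \sum_i mu i ->
  \sum_o G o <= 4 * c * N%:R ^+ 2 ->
  exists o, let w i := N%:R * mu i * (gap N y0 o (x i) (y i) <= N%:R^-1)%R%:R in
    c <= \sum_i w i - (54 * Ce)^-1 * (\sum_i \sum_j w i * w j * k i j `^ (- u)) - G o.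
Proof.
move=> k N0 Ce0 mu0 x01 yy0 en cmu Gle.
have N0' : 0 < N%:R :> R by rewrite ltr0n.
pose h o i := (gap N y0 o (x i) (y i) <= N%:R^-1)%R%:R : R.
pose w o i := N%:R * mu i * h o i.
pose E o := \sum_i \sum_j w o i * w o j * k i j `^ (- u).
suff : exists o, c <= \sum_i w o i - (54 * Ce)^-1 * E o - G o by [].
apply/not_existsP => no.
have : \sum_o (\sum_i w o i - (54 * Ce)^-1 * E o - G o) <
       \sum_(o : 'I_N * 'I_(4 * N)) c.
  have o0 : 'I_N * 'I_(4 * N).
    by split; [exact: (Ordinal N0)|apply: (@Ordinal _ 0); rewrite muln_gt0 N0].
  rewrite [ltLHS](bigD1 o0)//= [ltRHS](bigD1 o0)//=; apply: ltr_leD.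
    by rewrite ltNge; apply/negP/no.
  by apply: ler_sum => o _; rewrite leNgt; apply/negP => /ltW /no.
apply/negP; rewrite -leNgt sumr_const card_prod !card_ord.
rewrite !sumrB -mulr_sumr.
set mT := \sum_i mu i in cmu.
have M_ge : N%:R ^+ 2 * mT <= \sum_o \sum_i w o i.
  rewrite exchange_big/= /mT mulr_sumr; apply: ler_sum => i _.
  rewrite /w -mulr_sumr (_ : N%:R ^+ 2 * mu i = N%:R * mu i * N%:R); last by ring.
  apply: ler_wpM2l; first by rewrite mulr_ge0.
  exact: sum_gap_ge.
have k0 i j : 0 < k i j by rewrite /k lt_max invr_gt0 N0' orbT.
have E_le : \sum_o E o <= 27 * Ce * N%:R ^+ 2 * mT.
  rewrite /E exchange_big/= /mT mulr_sumr; apply: ler_sum => i _.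
  rewrite exchange_big/=.
  apply: (@le_trans _ _ (27 * N%:R ^+ 2 * mu i * \sum_j mu j * k i j `^ (- (u + 1)))); last first.
    rewrite (_ : 27 * Ce * N%:R ^+ 2 * mu i = 27 * N%:R ^+ 2 * mu i * Ce); last by ring.
    by apply: ler_wpM2l => //; rewrite !mulr_ge0// exprn_ge0.
  rewrite mulr_sumr; apply: ler_sum => j _.
  rewrite (eq_bigr (fun o => (N%:R ^+ 2 * mu i * mu j * k i j `^ (- u)) *
      (h o i * h o j))); last by move=> o _; rewrite /w; ring.
  rewrite -mulr_sumr.
  have -> : k i j `^ (- (u + 1)) = k i j `^ (- u) * (k i j)^-1.
    rewrite opprD powRD; last by apply/implyP => _; rewrite gt_eqF.
    by rewrite powR_inv1 ?ltW.
  apply: (@le_trans _ _ ((N%:R ^+ 2 * mu i * mu j * k i j `^ (- u)) * (27 / k i j))).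
    apply: ler_wpM2l; first by rewrite !mulr_ge0// ?exprn_ge0// powR_ge0.
    have yij : `|y i - y j| <= 1.
      by have := yy0 i; have := yy0 j; rewrite !ler_norml; lra.
    have xij : `|x i - x j| <= 1.
      by have := x01 i; have := x01 j; rewrite !ler_norml; lra.
    exact: sum_gap2_le.
  by rewrite le_eqVlt; apply/orP; left; apply/eqP; field; rewrite gt_eqF.
have : (54 * Ce)^-1 * \sum_o E o <= N%:R ^+ 2 * mT / 2.
  rewrite mulrC ler_pdivrMr ?mulr_gt0//; apply: le_trans E_le _.
  by rewrite le_eqVlt; apply/orP; left; apply/eqP; field.
move: M_ge Gle; rewrite -[c *+ _]mulr_natr !natrM.
have : 16 * c * N%:R ^+ 2 <= mT * N%:R ^+ 2 by rewrite ler_pM2r// exprn_gt0.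
rewrite expr2; lra.
Qed.

End Lines.

(** * Hausdorff dimension through finite covers *)

Lemma ler_powR_pos {R : realType} (v x y : R) : 0 <= v -> 0 <= x -> x <= y ->
  x `^ v <= y `^ v.
Proof.
by move=> v0 x0 xy; apply: ge0_ler_powR; rewrite ?nnegrE// (le_trans x0).
Qed.

Lemma powR_lt_inv {R : realType} (v x y : R) : 0 < v -> 0 <= y ->
  x `^ v < y `^ v -> x < y.
Proof.
move=> v0 y0; apply: contraTlt => yx; rewrite -leNgt.
exact: ler_powR_pos (ltW v0) _ _.
Qed.

Lemma sum_half_le1 (R : realType) n : \sum_(i < n) (2^-1 : R) ^+ i.+1 <= 1.
Proof.
have -> : \sum_(i < n) (2^-1 : R) ^+ i.+1 = 1 - 2^-1 ^+ n.
  elim: n => [|n IH]; first by rewrite big_ord0 expr0 subrr.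
  by rewrite big_ord_recr/= IH exprS; field.
by rewrite gerBl exprn_ge0.
Qed.

(** Finite lists keep all cost sums elementary; open balls let a cover of a slice also cover the
    thin strips around it. *)
Definition covers {R : realType} {T : normedModType R} (L : seq (T * R)) (A : set T) :=
  (forall q, q \in L -> 0 < q.2) /\
  forall x, A x -> exists2 q, q \in L & `|q.1 - x| < q.2.

(* For compact sets this is the vanishing of the [v]-dimensional Hausdorff
   measure, see [hmeasure_eq0_null] and [null_hmeasure_eq0]. *)
Definition null {R : realType} {T : normedModType R} (v : R) (A : set T) :=
  forall eta, 0 < eta ->
    exists2 L, covers L A & \sum_(q <- L) q.2 `^ v < eta.

Section Null.
Context {R : realType} {T : normedModType R}.
Implicit Types (A B : set T) (L : seq (T * R)) (u v eta : R).

Lemma covers_cat L L' A B : covers L A -> covers L' B -> covers (L ++ L') (A `|` B).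
Proof.
move=> [L0 LA] [L'0 L'B]; split=> [q|x [/LA|/L'B] [q qL qx]].
- by rewrite mem_cat => /orP[/L0|/L'0].
- by exists q; rewrite // mem_cat qL.
- by exists q; rewrite // mem_cat qL orbT.
Qed.

Lemma sub_null v A B : A `<=` B -> null v B -> null v A.
Proof.
move=> AB nB eta /nB[L [L0 LB] Leta]; exists L => //.
by split=> // x /AB/LB.
Qed.

Lemma null_setU v A B : null v A -> null v B -> null v (A `|` B).
Proof.
move=> nA nB eta eta0.
have eta20 : 0 < eta / 2 by rewrite divr_gt0.
have [L LA Ls] := nA _ eta20; have [L' LB L's] := nB _ eta20.
exists (L ++ L'); first exact: covers_cat.
by rewrite big_cat/=; lra.
Qed.

Lemma null_set0 v : null v (set0 : set T).
Proof. by move=> eta eta0; exists [::]; rewrite ?big_nil//; split. Qed.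

Lemma null_bigcup_ord v (A : nat -> set T) n :
  (forall i, (i < n)%N -> null v (A i)) -> null v (\bigcup_(i < n) A i).
Proof.
elim: n => [_|n IH nA]; first by rewrite II0 bigcup_set0; exact: null_set0.
rewrite IIS bigcup_setU bigcup_set1; apply: null_setU; last exact: nA.
by apply: IH => i ni; apply: nA; rewrite ltnS ltnW.
Qed.

(** A sum below 1 forces every radius to be at most 1, where powers decrease with the exponent. This
    does the work of a bound on the diameters. *)
Lemma sum_powR_le u v L : 0 <= u -> u <= v -> (forall q, q \in L -> 0 < q.2) ->
  \sum_(q <- L) q.2 `^ u < 1 -> \sum_(q <- L) q.2 `^ v <= \sum_(q <- L) q.2 `^ u.
Proof.
move=> u0 uv L0 Ls; rewrite big_seq [leRHS]big_seq; apply: ler_sum => q qL.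
have q0 := L0 q qL.
have qu1 : q.2 `^ u < 1.
  apply: le_lt_trans Ls; rewrite (big_rem q)//= lerDl.
  by apply: sumr_ge0 => *; exact: powR_ge0.
have q1 : q.2 <= 1.
  rewrite leNgt; apply/negP => q1; move: qu1; rewrite ltNge => /negP[].
  by have := ler_powR_pos u 1 q.2 u0 ler01 (ltW q1); rewrite powR1.
by rewrite ger_powR// q0.
Qed.

Lemma null_le u v A : 0 <= u -> u <= v -> null u A -> null v A.
Proof.
move=> u0 uv nA eta eta0.
have [|L [L0 LA]] := nA (Num.min eta 1); first by rewrite lt_min eta0/=.
rewrite lt_min => /andP[Ls1 Ls2]; exists L => //.
exact: le_lt_trans (sum_powR_le u v L u0 uv L0 Ls2) Ls1.
Qed.

Lemma compact_covers A (c : nat -> T) (rho : nat -> R) :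
  compact A -> (forall x, A x -> exists n, `|c n - x| < rho n) ->
  exists n0, forall x, A x -> exists2 n, (n < n0)%N & `|c n - x| < rho n.
Proof.
rewrite compact_cover => cA Ac.
have [| |D _ DA] := cA _ setT (fun n => ball (c n) (rho n)).
- move=> n _; exact: ball_open.
- move=> x /Ac[n xn]; exists n => //; by rewrite -ball_normE.
exists (\max_(i <- finmap.enum_fset D) i).+1 => x /DA[n nD]; rewrite -ball_normE => xn.
exists n => //; rewrite ltnS.
by apply: (@leq_bigmax_seq _ _ xpredT (fun i => i)).
Qed.

End Null.

(** * Null sets and Hausdorff measure for a metric within a factor 2 of the norm *)

Section NullMeasure.
Context {R : realType} {T : normedModType R} (d : T -> T -> R).
Context (d_ge : forall x y, `|x - y| <= d x y).
Context (d_le : forall x y, d x y <= 2 * `|x - y|).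

Let d_ge0 x y : 0 <= d x y.
Proof. exact: le_trans (d_ge x y). Qed.

Lemma diam_ge0 U : (0 <= diam d U)%E.
Proof.
rewrite /diam; case: (pselect (U = set0)) => /= U0 //; have /eqP/set0P[x Ux] := U0.
apply: (@le_trans _ _ (d x x)%:E); first by rewrite lee_fin.
by apply: ereal_sup_ubound; exists x => //; exists x.
Qed.

Lemma diam_le U M : 0 <= M -> (forall x y, U x -> U y -> d x y <= M) ->
  (diam d U <= M%:E)%E.
Proof.
move=> M0 UM; rewrite /diam; case: (pselect (U = set0)) => /= U0; first by rewrite lee_fin.
by apply: ge_ereal_sup => _ [x Ux [y Uy <-]]; rewrite lee_fin UM.
Qed.

Lemma dist_le_diam U x y M : (diam d U <= M%:E)%E -> U x -> U y ->
  d x y <= fine (diam d U).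
Proof.
move=> UM Ux Uy; rewrite -lee_fin fineK; last first.
  by rewrite ge0_fin_numE ?diam_ge0// (le_lt_trans UM)// ltry.
rewrite /diam; case: (pselect (U = set0)) => /= U0; first by rewrite U0 in Ux.
by apply: ereal_sup_ubound; exists x => //; exists y.
Qed.

Lemma diam_pow_ge0 v U : (0 <= diam_pow d v U)%E.
Proof. by rewrite /diam_pow; case: (pselect (U = set0)) => /= U0 //; rewrite lee_fin powR_ge0. Qed.

Lemma diam_powE v U : diam_pow d v U = (fine (diam_pow d v U))%:E.
Proof. by rewrite /diam_pow; case: pselect. Qed.

Lemma hcontent_ge0 v delta A : (0 <= hcontent d v delta A)%E.
Proof.
apply: le_ereal_inf_tmp => _ [U _ <-]; apply: nneseries_ge0 => n _ _.
exact: diam_pow_ge0.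
Qed.

Lemma hmeasure_eq0_cover v A eta : hmeasure d v A = 0%E -> 0 < eta ->
  exists2 U : nat -> set T, A `<=` \bigcup_n U n /\ (forall n, (diam d (U n) <= 1%:E)%E) &
    (\sum_(0 <= n <oo) diam_pow d v (U n) < eta%:E)%E.
Proof.
move=> h0 eta0.
have : (hcontent d v 1 A < eta%:E)%E.
  apply: (@le_lt_trans _ _ 0%E); last by rewrite lte_fin.
  by rewrite -h0; apply: ereal_sup_ubound; exists 1 => //=.
by move=> /ereal_inf_lt[_ [U [AU Ud] <-] lt]; exists U.
Qed.

(** With exponent 0 every nonempty covering set costs 1, even one of diameter 0. This settles the
    exponent 0 in [hdim], which the comparison with [null] leaves out. *)
Lemma hmeasure0_eq0 A : hmeasure d 0 A = 0%E -> A = set0.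
Proof.
move=> h0; apply/seteqP; split=> // x Ax.
have [U [AU Ud]] := hmeasure_eq0_cover 0 A 1 h0 ltr01.
rewrite ltNge => /negP[]; have [n _ Unx] := AU x Ax.
apply: le_trans (nneseries_lim_ge n.+1 _); last by move=> *; exact: diam_pow_ge0.
rewrite big_nat_recr//= -[leLHS]add0e leeD//.
  by apply: sume_ge0 => i _; exact: diam_pow_ge0.
rewrite /diam_pow; case: (pselect (U n = set0)) => /= U0; first by rewrite U0 in Unx.
by rewrite powRr0.
Qed.

Lemma hmeasure_eq0_null v A : 0 < v -> compact A -> hmeasure d v A = 0%E -> null v A.
Proof.
move=> v0 cA h0 eta eta0.
have eta20 : 0 < eta / 2 by rewrite divr_gt0.
have [U [AU Ud] Us] := hmeasure_eq0_cover v A _ h0 eta20.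
pose e n := fine (diam_pow d v (U n)).
have e0 n : 0 <= e n by apply: fine_ge0; exact: diam_pow_ge0.
pose g n : R := eta / 2 * 2^-1 ^+ n.+1.
have g0 n : 0 < g n by rewrite mulr_gt0// exprn_gt0.
(* the radius is chosen so that its [v]-th power exceeds that of the diameter by [g n] *)
pose rho n := (e n + g n) `^ v^-1.
have eg0 n : 0 < e n + g n by rewrite ltr_wpDl.
have rho0 n : 0 < rho n by exact: powR_gt0.
have rhov n : rho n `^ v = e n + g n.
  by rewrite -powRrM mulVf ?gt_eqF// powRr1// ltW.
pose c n := xget 0 (U n).
have [|n0 n0P] := compact_covers A c rho cA.
  move=> x /AU[n _ Unx]; exists n.
  have Unc : U n (c n) by exact: xgetI Unx.
  apply: le_lt_trans (d_ge _ _) _; apply: le_lt_trans (dist_le_diam (U n) _ _ _ (Ud n) Unc Unx) _.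
  apply: (powR_lt_inv v) => //; first exact: ltW.
  rewrite rhov /e /diam_pow; case: (pselect (U n = set0)) => /= U0; first by rewrite U0 in Unx.
  by rewrite /= ltrDl.
exists [seq (c n, rho n) | n <- iota 0 n0].
  split=> [q /mapP[n _ ->]|x /n0P[n nn0 xn]]; first exact: rho0.
  by exists (c n, rho n) => //; apply: map_f; rewrite mem_iota.
rewrite big_map (eq_bigr (fun n => e n + g n)) => [|n _]; last exact: rhov.
rewrite big_split/= -[iota 0 n0]/(iota 0 (0 + n0)).
have : \sum_(i <- iota 0 n0) e i < eta / 2.
  rewrite -lte_fin; apply: le_lt_trans Us.
  apply: le_trans (nneseries_lim_ge n0 _); last by move=> *; exact: diam_pow_ge0.
  rewrite /index_iota subn0 -sumEFin le_eqVlt; apply/orP; left; apply/eqP.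
  by apply: eq_bigr => i _; rewrite -diam_powE.
have : \sum_(i <- iota 0 n0) g i <= eta / 2.
  rewrite -mulr_sumr ger_pMr//.
  have := sum_half_le1 R n0; rewrite -(big_mkord xpredT (fun i => 2^-1 ^+ i.+1)).
  by rewrite /index_iota subn0.
rewrite add0n; lra.
Qed.

Lemma null_hmeasure_eq0 v A : 0 < v -> null v A -> hmeasure d v A = 0%E.
Proof.
move=> v0 nA; apply/eqP; rewrite eq_le; apply/andP; split; last first.
  apply: (@le_trans _ _ (hcontent d v 1 A)); first exact: hcontent_ge0.
  by apply: ereal_sup_ubound; exists 1 => //=.
apply: ge_ereal_sup => _ [delta /= delta0 <-].
apply/lee_addgt0Pr => eps eps0; rewrite add0e.
(* A ball of radius [r] has [d]-diameter at most [4 * r]. The first bound absorbs the resulting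
   factor in the sum; the second keeps each radius below [delta / 4]. *)
have [|L [L0 LA] Ls] := nA (Num.min (eps / 4 `^ v) ((delta / 4) `^ v)).
  by rewrite lt_min divr_gt0 ?powR_gt0//= divr_gt0.
rewrite lt_min in Ls; have /andP[Ls1 Ls2] := Ls.
have bd x y z r : `|z - x| < r -> `|z - y| < r -> d x y <= 4 * r.
  move=> zx zy; apply: le_trans (d_le x y) _.
  have : `|x - y| <= `|x - z| + `|z - y| by exact: ler_distD.
  rewrite (distrC x z); lra.
pose q0 : T * R := (0, 0).
pose U n := if (n < size L)%N then
  [set x | `|(nth q0 L n).1 - x| < (nth q0 L n).2] else set0.
have Ud n : (n < size L)%N -> (diam d (U n) <= (4 * (nth q0 L n).2)%:E)%E.
  move=> nL; apply: diam_le.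
    by rewrite mulr_ge0// ltW// L0// mem_nth.
  by rewrite /U nL => x y; exact: bd.
apply: (@le_trans _ _ (\sum_(0 <= n <oo) diam_pow d v (U n))%E).
  apply: ereal_inf_lbound; exists U => //; split=> [x /LA[q qL qx]|n].
    exists (index q L) => //; rewrite /U index_mem qL/=.
    by rewrite nth_index.
  have [nL|nL] := ltnP n (size L); last first.
    by rewrite /U ltnNge nL/=; apply: diam_le => //; exact: ltW.
  apply: le_trans (Ud n nL) _; rewrite lee_fin -ler_pdivlMl// mulrC.
  apply/ltW/(powR_lt_inv v) => //; first by rewrite divr_ge0// ltW.
  apply: le_lt_trans Ls2; rewrite (big_rem (nth q0 L n)) ?mem_nth//= lerDl.
  by apply: sumr_ge0 => *; exact: powR_ge0.
have Up n : (n < size L)%N ->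
    (diam_pow d v (U n) <= (4 `^ v * (nth q0 L n).2 `^ v)%:E)%E.
  move=> nL; rewrite /diam_pow; case: (pselect (U n = set0)) => /= Un0.
    by rewrite lee_fin mulr_ge0 ?powR_ge0.
  have q2 : 0 <= (nth q0 L n).2 by rewrite ltW// L0// mem_nth.
  rewrite lee_fin -powRM//; apply: ler_powR_pos; first exact: ltW.
    by apply: fine_ge0; exact: diam_ge0.
  rewrite -lee_fin fineK ?Ud// ge0_fin_numE ?diam_ge0//.
  by rewrite (le_lt_trans (Ud n nL))// ltry.
rewrite (nneseries_split 0 (size L)) => [|*]; last exact: diam_pow_ge0.
rewrite add0n eseries0; last first.
  move=> n /= nL _; rewrite /diam_pow /U ltnNge nL/=.
  by case: (pselect (_ = _)).
rewrite adde0.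
apply: (@le_trans _ _ (4 `^ v * \sum_(q <- L) q.2 `^ v)%:E); last first.
  by rewrite lee_fin -ler_pdivlMl ?powR_gt0// mulrC ltW.
rewrite (big_nth q0) mulr_sumr -sumEFin !big_mkord.
by apply: lee_sum => i _; exact: Up.
Qed.

Lemma hdim_null A (s v : R) : compact A -> 0 < s -> hdim d A = s%:E -> s < v -> null v A.
Proof.
move=> cA s0 dA sv.
have : (hdim d A < v%:E)%E by rewrite dA lte_fin.
move=> /ereal_inf_lt[_ [u [u0 hu] <-]]; rewrite lte_fin => uv.
have su : s <= u.
  by rewrite -lee_fin -dA; apply: ereal_inf_lbound; exists u.
apply: null_le (ltW uv) _ => //; apply: hmeasure_eq0_null => //.
exact: lt_le_trans su.
Qed.

Lemma hdim_not_null A (s v : R) : hdim d A = s%:E -> 0 < v -> v < s -> ~ null v A.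
Proof.
move=> dA v0 vs /(null_hmeasure_eq0 v A v0) hv; move: vs; rewrite ltNge => /negP[].
by rewrite -lee_fin -dA; apply: ereal_inf_lbound; exists v => //; split=> //; exact: ltW.
Qed.

Lemma hdim_eq A (s : R) : compact A -> 0 < s ->
  (forall v, s < v -> null v A) -> (forall v, 0 < v -> v < s -> ~ null v A) ->
  hdim d A = s%:E.
Proof.
move=> cA s0 nA nnA; apply/eqP; rewrite eq_le; apply/andP; split.
  apply/lee_addgt0Pr => e e0; apply: ereal_inf_lbound; exists (s + e) => //=.
  split; first by rewrite addr_ge0// ltW.
  by apply: null_hmeasure_eq0; rewrite ?addr_gt0//; apply: nA; rewrite ltrDl.
apply: le_ereal_inf_tmp => _ [v [v0 hv] <-]; rewrite lee_fin leNgt; apply/negP => vs.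
move: v0; rewrite le_eqVlt => /predU1P[v0|v0].
  rewrite -v0 in hv; apply: (nnA (s / 2)); rewrite ?divr_gt0//; first by lra.
  by rewrite (hmeasure0_eq0 A hv); exact: null_set0.
by apply: (nnA v) => //; exact: hmeasure_eq0_null.
Qed.

End NullMeasure.

Lemma dist1_norm {R : realType} (x y : R) :
  `|x - y| <= dist1 x y /\ dist1 x y <= 2 * `|x - y|.
Proof. by rewrite /dist1; split=> //; have := normr_ge0 (x - y); lra. Qed.

Lemma dist2_norm {R : realType} (p q : R * R) :
  `|p - q| <= dist2 p q /\ dist2 p q <= 2 * `|p - q|.
Proof.
rewrite /dist2 prod_normE/=; set x := p.1 - q.1; set y := p.2 - q.2.
have x0 := sqr_ge0 x; have y0 := sqr_ge0 y.
split.
  rewrite ge_max -!sqrtr_sqr; apply/andP; split; apply: ler_wsqrtr.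
    by rewrite lerDl.
  by rewrite lerDr.
set m := Num.max _ _.
have xm : `|x| <= m by rewrite le_max lexx.
have ym : `|y| <= m by rewrite le_max lexx orbT.
have m0 : 0 <= m by exact: le_trans xm.
rewrite -[leRHS]ger0_norm ?mulr_ge0// -sqrtr_sqr; apply: ler_wsqrtr.
have : `|x| ^+ 2 <= m ^+ 2 by rewrite ler_sqr ?nnegrE.
have : `|y| ^+ 2 <= m ^+ 2 by rewrite ler_sqr ?nnegrE.
by rewrite !real_normK ?num_real// exprMn; lra.
Qed.

(** * Slices of the graph *)

Lemma compact_net {R : realType} {T : normedModType R} (A : set T) (e : R) :
  compact A -> 0 < e -> exists s : seq T, (forall p, p \in s -> A p) /\
    forall x, A x -> exists2 p, p \in s & `|p - x| < e.
Proof.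
rewrite compact_cover => cA e0.
have [| |D DA AD] := cA T A (fun p => ball p e).
- by move=> p _; exact: ball_open.
- by move=> x Ax; exists x => //; exact: ballxx.
exists (finmap.enum_fset D); split=> [p /DA|x /AD[p pD]]; first by rewrite inE.
by rewrite -ball_normE => px; exists p.
Qed.

Lemma within_continuous_pair {R : realType} (K : set R) (f : R -> R) :
  {within K, continuous f} -> {within K, continuous (fun x => (x, f x))}.
Proof.
move/subspace_continuousP => cf; apply/subspace_continuousP => x Kx.
have idx : y @[y --> within K (nbhs x)] --> x by exact: cvg_within.
exact: cvg_pair idx (cf x Kx).
Qed.

Lemma graph_compact {R : realType} (K : set R) (f : R -> R) :
  compact K -> {within K, continuous f} -> compact (graph f K).
Proof.
by move=> cK cf; apply: continuous_compact cK; exact: within_continuous_pair.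
Qed.

(** Non-nullity yields one [eta] below the cost of every finite cover. Both constants depend only on
    [eta], [t] and [t'], hence are uniform in [n]. *)
Lemma graph_frostman {R : realType} (K : set R) (f : R -> R) (t t' : R) :
  compact (graph f K) ->
  (forall x y, K x -> K y -> `|x - y| <= 1) ->
  (forall x y, K x -> K y -> `|f x - f y| <= 1) ->
  0 <= t -> t < t' -> ~ null t' (graph f K) ->
  exists2 c, 0 < c & exists2 C, 0 < C & forall n, exists (k : nat) (x mu : 'I_k -> R),
    [/\ forall i, K (x i), forall i, 0 <= mu i, c <= \sum_i mu i &
      forall i, \sum_j mu j *
        (Num.max (Num.max `|x i - x j| `|f (x i) - f (x j)|) (2^-1 ^+ n)) `^ (- t) <= C].
Proof.
move=> cG dx dy t0 tt' nn.
have [eta eta0 etaP] : exists2 eta, 0 < eta &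
    forall L, covers L (graph f K) -> eta <= \sum_(q <- L) q.2 `^ t'.
  apply: contrapT => h; apply: nn => eta eta0; apply: contrapT => h'; apply: h.
  exists eta => // L LG; rewrite leNgt; apply/negP => Ls; apply: h'.
  by exists L.
have [C C0 CP] := energy_bound R t t' t0 tt'.
have c0 : 0 < eta / 5 `^ t' by rewrite divr_gt0// powR_gt0.
exists (eta / 5 `^ t') => //; exists C => // n.
set a : R := 2^-1.
have a0 : 0 < a by rewrite /a invr_gt0.
have a1 : a < 1 by rewrite /a invf_lt1// ltr1n.
have an l : 0 < a ^+ l by exact: exprn_gt0.
have [s [sG Gs]] := compact_net _ _ cG (an n).
pose p (i : 'I_(size s)) := tnth (in_tuple s) i.
have pG i : graph f K (p i) by apply/sG/mem_tnth.
have pE i : (p i).2 = f (p i).1 /\ K (p i).1 by case: (pG i) => x Kx <-.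
have pn i j : `|p i - p j| = Num.max `|(p i).1 - (p j).1| `|f (p i).1 - f (p j).1|.
  by rewrite prod_normE/=; have [-> _] := pE i; have [-> _] := pE j.
have [|||||mu [mu0 muB [S Scov Ssum]]] :=
  finite_frostman R _ (fun i j => `|p i - p j|) a t' n.
- by rewrite !ltW.
- by rewrite (le_trans t0)// ltW.
- by move=> i; rewrite subrr normr0.
- by move=> i j; rewrite distrC.
- by move=> i j k; exact: ler_distD.
exists (size s), (fun i => (p i).1), mu; split=> //.
- by move=> i; have [] := pE i.
(* The factor 3 reaches every point of the net and one more radius reaches the graph; 5 leaves room
   for the strict inequality. *)
- pose L := [seq (p q.1, 5 * a ^+ q.2) | q : 'I_(size s) * 'I_n.+1 <- enum S].
  have LG : covers L (graph f K).
    split=> [_ /mapP[q _ ->]|x Gx]; first by rewrite mulr_gt0.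
    have [y ys yx] := Gs x Gx.
    have [k ky] : exists k, p k = y.
      by have /tnthP[k ->] : y \in in_tuple s by []; exists k.
    have [q qS qk] := Scov k.
    exists (p q.1, 5 * a ^+ q.2); first by apply: map_f; rewrite mem_enum.
    apply: le_lt_trans (ler_distD y _ _) _; rewrite -ky in yx *.
    have : a ^+ n <= a ^+ q.2.
      by rewrite ler_wiXn2l// ?ltW// -ltnS.
    have := an q.2; rewrite -mulr_natr in qk; move: qk yx => /=; lra.
  have := etaP L LG; rewrite big_map big_enum/=.
  rewrite (eq_bigr (fun q : 'I_(size s) * 'I_n.+1 => 5 `^ t' * (a ^+ q.2) `^ t')); last first.
    by move=> q _; rewrite powRM// ltW.
  rewrite -mulr_sumr => h; rewrite ler_pdivrMr ?powR_gt0// mulrC.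
  by apply: le_trans h _; rewrite ler_pM2l// powR_gt0.
- move=> i; have := CP _ mu (fun j => `|p i - p j|) n mu0.
  rewrite (eq_bigr (fun j => mu j * Num.max (Num.max `|(p i).1 - (p j).1|
    `|f (p i).1 - f (p j).1|) (2^-1 ^+ n) `^ (- t))); last by move=> j _; rewrite pn.
  apply; last exact: muB.
  move=> j; rewrite pn ge_max dx ?dy//; by [have [] := pE i|have [] := pE j].
Qed.

(* The energy argument picks a line at scale [2^-n] whose neighbourhood meets the
   graph in a set of large capacity, while keeping the prescribed cost [g] small. *)
Lemma approximate_slice {R : realType} (K : set R) (f : R -> R) (y0 t t' : R) :
  compact (graph f K) -> K `<=` `[0, 1] ->
  (forall x, K x -> `|f x - y0| <= 2^-1) ->
  1 < t -> t < t' -> ~ null t' (graph f K) ->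
  exists2 c, 0 < c & exists2 C, 0 < C & forall (n : nat) (g : R -> R -> R),
    let N := (2 ^ n)%N in
    \sum_(o : 'I_N * 'I_(4 * N)) g (slope N o) (intercept N y0 o) <= 4 * c * N%:R ^+ 2 ->
    exists m b, [/\ 0 <= m <= 1, y0 - 2 <= b <= y0 + 2 &
      forall L : seq (R * R), (forall q, q \in L -> 2^-1 ^+ n <= q.2) ->
        (forall x, K x -> `|f x - m * x - b| <= 2^-1 ^+ n ->
           exists2 q, q \in L & `|q.1 - x| < q.2) ->
        c + g m b <= C * \sum_(q <- L) q.2 `^ (t - 1)].
Proof.
move=> cG K01 fy0 t1 tt' nn.
have K01' x : K x -> 0 <= x <= 1 by move/K01; rewrite /= in_itv.
have t0 : 0 <= t by lra.
have u0 : 0 <= t - 1 by lra.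
have [| |c c0 [Ce Ce0 fr]] := graph_frostman K f t t' cG _ _ t0 tt' nn.
- by move=> x y /K01' ? /K01' ?; rewrite ler_norml; lra.
- by move=> x y /fy0 + /fy0; rewrite !ler_norml; lra.
pose lam := (54 * Ce)^-1.
have lam0 : 0 < lam by rewrite invr_gt0 mulr_gt0.
exists (c / 16); first by rewrite divr_gt0.
exists (4 `^ (t - 1) / (4 * lam)); first by rewrite divr_gt0 ?powR_gt0// mulr_gt0.
move=> n g N gN.
have N0 : (0 < N)%N by rewrite expn_gt0.
have N0' : 0 < N%:R :> R by rewrite ltr0n.
have NE : N%:R^-1 = 2^-1 ^+ n :> R by rewrite natrX exprVn.
have [k [x [mu [Kx mu0 cmu en]]]] := fr n.
have [|||||o] := exists_good_line _ N y0 x (f \o x) mu (t - 1) Ce (c / 16)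
    (fun o => g (slope N o) (intercept N y0 o)) N0 Ce0 mu0.
- by move=> i; exact: K01'.
- by move=> i; exact: fy0.
- by move=> i; rewrite subrK NE; exact: en.
- by rewrite mulrC divfK.
- exact: gN.
set m := slope N o; set b := intercept N y0 o => /= ho.
have m01 : 0 <= m <= 1.
  rewrite divr_ge0//= ler_pdivrMr// mul1r ler_nat; exact/ltnW.
exists m, b; split=> //.
  have : 0 <= (o.2%:R / N%:R : R) <= 4.
    rewrite divr_ge0//= ler_pdivrMr// -natrM ler_nat; exact/ltnW.
  rewrite /b /intercept; lra.
move=> L LN LK.
pose w i := N%:R * mu i * (gap N y0 o (x i) (f (x i)) <= N%:R^-1)%R%:R.
have wgap i : w i != 0 -> `|f (x i) - m * x i - b| <= 2^-1 ^+ n.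
  rewrite /w -NE; case: (boolP (gap _ _ _ _ _ <= _)) => //.
  by rewrite mulr0 eqxx.
have L0 q : q \in L -> 0 < q.2.
  by move/LN; apply: lt_le_trans; rewrite exprn_gt0// invr_gt0.
(* Two points of the strip over the same interval of radius [q.2] have abscissae within [2 * q.2].
   As the slope is at most 1 and the strip has half-width at most [q.2], their ordinates are within
   [4 * q.2], hence the value of [kap]. *)
have := capacity_bound R _ _ L (fun q i => `|q.1 - x i| < q.2)
  (fun q => (4 * q.2) `^ (t - 1)) w
  (fun i j => Num.max (Num.max `|x i - x j| `|f (x i) - f (x j)|) N%:R^-1 `^ (- (t - 1)))
  lam lam0.
have -> : \sum_(q <- L) (4 * q.2) `^ (t - 1) / (4 * lam) =
    4 `^ (t - 1) / (4 * lam) * \sum_(q <- L) q.2 `^ (t - 1).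
  rewrite mulr_sumr big_seq [RHS]big_seq; apply: eq_bigr => q /L0 q0.
  by rewrite powRM// ?ltW// mulrAC.
move=> cap; move: ho; rewrite -/lam.
suff : \sum_i w i - lam * \sum_i \sum_j w i * w j *
    Num.max (Num.max `|x i - x j| `|f (x i) - f (x j)|) N%:R^-1 `^ (- (t - 1)) <=
    4 `^ (t - 1) / (4 * lam) * \sum_(q <- L) q.2 `^ (t - 1).
  rewrite /w /=; set A := \sum_i _; set B := \sum_i _; lra.
apply: cap.
- by move=> q /L0 q0; rewrite powR_gt0// mulr_gt0.
- by move=> i; rewrite !mulr_ge0.
- by move=> i j; exact: powR_ge0.
- by move=> i /wgap wi; apply: LK.
- move=> q i j qL qi qj /wgap wi /wgap wj; have q0 := L0 q qL.
  rewrite powRN lef_pV2 ?posrE ?powR_gt0//; last 2 first.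
  - by rewrite mulr_gt0.
  - by rewrite lt_max invr_gt0 N0' orbT.
  apply: ler_powR_pos; [exact: u0|by rewrite !le_max invr_ge0 ler0n orbT|].
  have xij : `|x i - x j| <= 2 * q.2.
    by move: qi qj; rewrite !ltr_norml ler_norml; lra.
  have qn := LN q qL.
  rewrite NE !ge_max; apply/andP; split; last by lra.
  apply/andP; split; first by lra.
  have : `|m * (x i - x j)| <= 2 * q.2.
    rewrite normrM (le_trans _ xij)// ler_piMl// ger0_norm; lra.
  move: wi wj; rewrite !ler_norml mulrBr; lra.
Qed.

Lemma half_exp_le {R : realType} (r : R) : 0 < r ->
  exists n, forall m, (n <= m)%N -> 2^-1 ^+ m <= r.
Proof.
move=> r0; pose k := (Num.truncn r^-1).+1.
have kr : r^-1 < k%:R.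
  have ri : 0 <= r^-1 by rewrite invr_ge0 ltW.
  by have /andP[] := truncn_itv ri.
exists k => m km; rewrite exprVn invf_ple ?posrE ?exprn_gt0//.
rewrite (le_trans (ltW kr))// -natrX ler_nat (leq_trans km)// ltnW//.
exact: ltn_expl.
Qed.

Lemma half_exp_le_seq {R : realType} {T : eqType} (L : seq T) (r : T -> R) :
  (forall q, q \in L -> 0 < r q) ->
  exists n, forall m, (n <= m)%N -> forall q, q \in L -> 2^-1 ^+ m <= r q.
Proof.
elim: L => [|x L IH] L0; first by exists 0%N.
have [q qL|n nP] := IH; first by apply: L0; rewrite inE qL orbT.
have [k kP] := half_exp_le (r x) (L0 x (mem_head _ _)).
exists (maxn n k) => m; rewrite geq_max => /andP[nm km] q.
by rewrite inE => /predU1P[->|]; [exact: kP|exact: nP].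
Qed.

Definition slice {R : realType} (K : set R) (f : R -> R) (m b : R) : set R :=
  [set x | K x /\ f x = m * x + b].

Lemma within_continuous_dist {R : realType} (K : set R) (f : R -> R) (m b : R) :
  {within K, continuous f} -> {within K, continuous (fun x => `|f x - m * x - b|)}.
Proof.
move/subspace_continuousP => cf; apply/subspace_continuousP => x Kx.
have idx : y @[y --> within K (nbhs x)] --> x by exact: cvg_within.
apply: (@cvg_norm _ _ _ _ _ (fun x => f x - m * x - b)).
by apply: cvgB; [apply: cvgB; [exact: cf|exact: cvgMr idx]|exact: cvg_cst].
Qed.

Lemma slice_compact {R : realType} (K : set R) (f : R -> R) (m b : R) :
  compact K -> {within K, continuous f} -> compact (slice K f m b).
Proof.
move=> cK cf; have clK : closed K by apply: compact_closed cK; exact: Rhausdorff.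
suff : closed (slice K f m b).
  by move=> cl; apply: subclosed_compact cl cK _ => x [].
have /continuous_closedP h := within_continuous_dist K f m b cf.
have := h [set 0] (@closed_eq R 0); rewrite -(closed_setIS _ clK).
congr closed; apply/seteqP; split => [x [/= /normr0_eq0 h0 Kx]|x [Kx fx]]; split => //=.
  lra.
suff : `|f x - m * x - b| = 0 by [].
by apply/eqP; rewrite normr_eq0 fx; apply/eqP; ring.
Qed.

(** The function [|f x - m * x - b|] does not vanish on the compact set [K] minus [U], so it stays
    away from 0 there. *)
Lemma near_slice_subset {R : realType} (K : set R) (f : R -> R) (m b : R) (U : set R) :
  compact K -> {within K, continuous f} -> open U -> slice K f m b `<=` U ->
  exists2 e, 0 < e & forall x, K x -> `|f x - m * x - b| < e -> U x.
Proof.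
move=> cK cf oU FU.
have cB : compact (K `&` ~` U).
  have cl : closed (K `&` ~` U).
    apply: closedI; last exact: open_closedC.
    by apply: compact_closed cK; exact: Rhausdorff.
  exact: subclosed_compact cl cK (@subIsetl _ _ _).
pose h x := `|f x - m * x - b|.
have ch : {within K `&` ~` U, continuous h}.
  apply: (continuous_subspaceW _ (within_continuous_dist K f m b cf)) => x [] //.
have cI := compact_closed (@Rhausdorff R) (continuous_compact ch cB).
have I0 : (~` (h @` (K `&` ~` U))) 0.
  move=> [x [Kx nUx] /normr0_eq0 hx]; apply: nUx; apply: FU; split => //; lra.
have /nbhs_ballP[e /= e0 eB] : nbhs 0 (~` (h @` (K `&` ~` U))).
  by apply: open_nbhs_nbhs; split => //; exact: closed_openC.
exists e => // x Kx hx; apply: contrapT => nUx.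
apply: (eB (h x)); last by exists x.
by rewrite -ball_normE /= sub0r normrN normr_id.
Qed.

Lemma cluster_seq {R : realType} (mb : nat -> R * R) (P : set (R * R)) :
  compact P -> (forall J, P (mb J)) ->
  exists2 p, P p & forall (e : R) J0, 0 < e -> exists2 J, (J0 <= J)%N &
    `|p.1 - (mb J).1| < e /\ `|p.2 - (mb J).2| < e.
Proof.
move=> cP PJ.
have [|p [Pp clp]] := cP (mb @ \oo) _.
  by exists 0%N => // J _; exact: PJ.
exists p => // e J0 e0.
have [|z [[J /= J0J <-]]] := clp [set mb J | J in [set J | (J0 <= J)%N]] _ _ (nbhsx_ballx p e e0).
  by exists J0 => // J /= J0J; exists J.
by rewrite -ball_normE /= prod_normE/= gt_max => /andP[? ?]; exists J.
Qed.

Lemma exists_slice {R : realType} (K : set R) (f : R -> R) (y0 s t t' : R) :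
  compact K -> {within K, continuous f} -> K `<=` `[0, 1] ->
  (forall x, K x -> `|f x - y0| <= 2^-1) ->
  1 < s -> 1 < t -> t < t' -> ~ null t' (graph f K) ->
  (forall v, s < v -> null v (graph f K)) ->
  exists m b, ~ null (t - 1) (slice K f m b) /\
    forall v, s - 1 < v -> null v (slice K f m b).
Proof.
move=> cK cf K01 fy0 s1 t1 tt' nn nG.
have cG := graph_compact K f cK cf.
have [c c0 [C C0 app]] := approximate_slice K f y0 t t' cG K01 fy0 t1 tt' nn.
pose v j := s + j.+1%:R^-1.
have sv j : s < v j by rewrite ltrDl invr_gt0.
(* The factor [2^-1 ^+ j.+1] makes the budgets summable. Dividing by [j.+1] pays for the weight
   [j.+1] in [g], and that weight will force the [j]-th cost of a good line to be at most
   [C / j.+1]. *)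
have /choice[L LP] j : exists L, covers L (graph f K) /\
    \sum_(q <- L) q.2 `^ (v j) < c / 2 * 2^-1 ^+ j.+1 / j.+1%:R.
  have [|L LG Ls] := nG (v j) (sv j) (c / 2 * 2^-1 ^+ j.+1 / j.+1%:R).
    by rewrite !(divr_gt0, mulr_gt0, exprn_gt0, invr_gt0).
  by exists L.
have L0 j q : q \in L j -> 0 < q.2 by have [[+ _] _] := LP j; exact.
have LG j : covers (L j) (graph f K) by have [] := LP j.
(* The grid must be finer than all radii of the first [J] covers for [sum_gap_le] to apply; [J <= n]
   makes the scale tend to 0. *)
have /choice[n nP] J : exists n, (J <= n)%N /\
    forall j, (j < J)%N -> forall q, q \in L j -> 2^-1 ^+ n <= q.2.
  have [|n nP] := half_exp_le_seq (flatten [seq L j | j <- iota 0 J]) (fun q => q.2).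
    by move=> q /flatten_mapP[j _]; exact: L0.
  exists (maxn J n); split; first exact: leq_maxl.
  move=> j jJ q qL; apply: nP; first exact: leq_maxr.
  by apply/flatten_mapP; exists j => //; rewrite mem_iota.
(* Summed over the lines, [h] gives at most [7 * N ^ 2] times the power [v j] of the radius. The 3
   consists of 2 for the limit line and 1 for passing to a nearby line. *)
pose h j (q : R * R * R) (m b : R) : R := q.2 `^ (v j - 1) * (`|q.1.2 - m * q.1.1 - b| < 3 * q.2)%R%:R.
pose g J (m b : R) : R := \sum_(j < J) j.+1%:R * \sum_(q <- L j) h j q m b.
have gN J : let N := (2 ^ n J)%N in
    \sum_(o : 'I_N * 'I_(4 * N)) g J (slope N o) (intercept N y0 o) <= 4 * c * N%:R ^+ 2.
  move=> N; have N0 : (0 < N)%N by rewrite expn_gt0.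
  have NE : N%:R^-1 = 2^-1 ^+ n J :> R by rewrite natrX exprVn.
  rewrite exchange_big/=.
  apply: (@le_trans _ _ (\sum_(j < J) 7 / 2 * c * N%:R ^+ 2 * 2^-1 ^+ j.+1)).
    apply: ler_sum => j _; rewrite -mulr_sumr exchange_big/=.
    apply: (@le_trans _ _ (j.+1%:R * \sum_(q <- L j) (7 * N%:R ^+ 2 * q.2 `^ v j))).
      apply: ler_wpM2l => //; rewrite big_seq [leRHS]big_seq.
      apply: ler_sum => q qL; have q0 := L0 j q qL.
      rewrite /h -mulr_sumr.
      have -> : q.2 `^ v j = q.2 `^ (v j - 1) * q.2.
        rewrite -[X in _ * X](powRr1 (ltW q0)) -powRD ?subrK//.
        by apply/implyP => _; rewrite gt_eqF.
      rewrite (_ : 7 * _ * _ = q.2 `^ (v j - 1) * (7 * q.2 * N%:R ^+ 2)); last by ring.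
      apply: ler_wpM2l; first exact: powR_ge0.
      apply: sum_gap_le => //; rewrite NE.
      by have [_ nJ] := nP J; exact: (nJ j (ltn_ord j)).
    rewrite -mulr_sumr; have [_ /ltW Ls] := LP j.
    rewrite ler_pdivlMr// in Ls.
    have : 7 * N%:R ^+ 2 * ((\sum_(q <- L j) q.2 `^ v j) * j.+1%:R) <=
           7 * N%:R ^+ 2 * (c / 2 * 2^-1 ^+ j.+1).
      by apply: ler_wpM2l => //; rewrite mulr_ge0// exprn_ge0.
    set X := \sum_(q <- _) _; set Y := 2^-1 ^+ _; lra.
  rewrite -mulr_sumr.
  have N2 : 0 <= 7 / 2 * c * N%:R ^+ 2 by rewrite !mulr_ge0 ?exprn_ge0// ltW.
  apply: le_trans (ler_wpM2l N2 (sum_half_le1 R J)) _.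
  by rewrite mulr1; apply: ler_wpM2r; [exact: exprn_ge0|lra].
have {}app J : exists mb : R * R, [/\ 0 <= mb.1 <= 1, y0 - 2 <= mb.2 <= y0 + 2 &
    forall L' : seq (R * R), (forall q, q \in L' -> 2^-1 ^+ n J <= q.2) ->
        (forall x, K x -> `|f x - mb.1 * x - mb.2| <= 2^-1 ^+ n J ->
           exists2 q, q \in L' & `|q.1 - x| < q.2) ->
        c + g J mb.1 mb.2 <= C * \sum_(q <- L') q.2 `^ (t - 1)].
  by have [m [b mbP]] := app (n J) (g J) (gN J); exists (m, b).
have {app}[mb mbP] := choice app.
have cP : compact (`[0, 1]%classic `*` `[y0 - 2, y0 + 2]%classic : set (R * R)).
  by apply: compact_setX; exact: segment_compact.
have [|[m b] [/= m01 b02] freq] := cluster_seq mb _ cP.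
  by move=> J; have [m01 b02 _] := mbP J; split; rewrite /= in_itv.
rewrite /= in_itv/= in m01; have /andP[m0 m1] := m01.
have g0 J m' b' j : (j < J)%N -> 0 <= j.+1%:R * \sum_(q <- L j) h j q m' b' <= g J m' b'.
  move=> jJ; have pos i : 0 <= i.+1%:R * \sum_(q <- L i) h i q m' b'.
    by rewrite mulr_ge0// sumr_ge0// => q _; rewrite mulr_ge0// powR_ge0.
  by rewrite pos /g (bigD1 (Ordinal jJ))//= lerDl sumr_ge0.
have g00 J m' b' : 0 <= g J m' b'.
  apply: sumr_ge0 => j _.
  by rewrite mulr_ge0// sumr_ge0// => q _; rewrite mulr_ge0// powR_ge0.
have half_lt J : 2^-1 ^+ n J <= 2^-1 ^+ J :> R.
  by have [Jn _] := nP J; rewrite ler_wiXn2l// ?invr_ge0// invf_le1// ler1n.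
exists m, b; split.
  (* a cheap cover of the limit slice also covers the nearby approximate ones *)
  have cC : 0 < c / C by rewrite divr_gt0.
  move=> /(_ _ cC)[L' [L'0 L'F] L's].
  have oU : open (\bigcup_(q in [set` L']) ball q.1 q.2 : set R).
    by apply: bigcup_open => q _; exact: ball_open.
  have [|e e0 eP] := near_slice_subset K f m b _ cK cf oU.
    by move=> x /L'F[q qL qx]; exists q; rewrite // -ball_normE.
  have [n1 n1P] := half_exp_le_seq L' (fun q => q.2) L'0.
  have e40 : 0 < e / 4 by rewrite divr_gt0.
  have [n2 n2P] := half_exp_le _ e40.
  have [J JJ [mJ bJ]] := freq (e / 4) (maxn n1 n2) e40.
  move: JJ; rewrite geq_max => /andP[n1J n2J].
  have nJe : 2^-1 ^+ n J <= e / 4.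
    by apply: le_trans (half_lt J) _; exact: n2P.
  have [_ _ /(_ L')] := mbP J.
  have : C * \sum_(q <- L') q.2 `^ (t - 1) < c.
    by rewrite mulrC -ltr_pdivlMr.
  have := g00 J (mb J).1 (mb J).2.
  move=> ? ? contra; suff : c + g J (mb J).1 (mb J).2 <= C * \sum_(q <- L') q.2 `^ (t - 1).
    by lra.
  apply: contra => [q qL|x Kx hx].
    by apply: le_trans (half_lt J) _; exact: n1P.
  have [|q qL] := eP x Kx; last by rewrite -ball_normE => qx; exists q.
  have /K01 := Kx; rewrite /= in_itv/= => /andP[x0 x1].
  have mx : `|(m - (mb J).1) * x| <= e / 4.
    by rewrite normrM (le_trans _ (ltW mJ))// ler_piMr// ger0_norm.
  move: mx hx bJ nJe; rewrite ler_norml ltr_norml !ler_norml ltr_norml mulrBl /=; lra.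
move=> w sw eta eta0.
have eta1 : 0 < Num.min eta 1 by rewrite lt_min eta0/=.
(* The first condition transfers nullity to the exponent [w]. The second makes [C / j.+1] smaller
   than [eta], and than 1 as [sum_powR_le] requires. *)
have [j [vw Cj]] : exists j, v j - 1 <= w /\ C < Num.min eta 1 * j.+1%:R.
  pose X := C / Num.min eta 1 + (w - (s - 1))^-1.
  have w0 : 0 < (w - (s - 1))^-1 by rewrite invr_gt0 subr_gt0.
  have X0 : 0 < C / Num.min eta 1 by rewrite divr_gt0.
  have /andP[_ Xt] := truncn_itv (ltW (addr_gt0 X0 w0)).
  exists (Num.truncn X); split.
    have : (Num.truncn X).+1%:R^-1 <= w - (s - 1).
      by rewrite invf_ple ?posrE ?subr_gt0//; lra.
    rewrite /v; move: ((Num.truncn X).+1%:R^-1) => z; lra.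
  by rewrite mulrC -ltr_pdivrMr//; lra.
(* These are the horizontal projections of the squares of [L j] close to the limit line. A square
   containing a point of the slice passes the test with 2, because the slope is at most 1. *)
pose L' := [seq (q.1.1, q.2) | q <- L j & `|q.1.2 - m * q.1.1 - b| <= 2 * q.2].
have L'F : covers L' (slice K f m b).
  split=> [_ /mapP[q + ->]|x [Kx fx]].
    by rewrite mem_filter => /andP[_ /L0].
  have [_ /(_ (x, f x))] := LG j; case; first by exists x.
  move=> q qL; rewrite prod_normE/= gt_max => /andP[qx qf].
  exists (q.1.1, q.2) => //; apply: map_f; rewrite mem_filter qL andbT.
  have mx : `|m * (q.1.1 - x)| <= q.2.
    by rewrite normrM (le_trans _ (ltW qx))// ler_piMl// ger0_norm.
  move: mx qf; rewrite fx !ler_norml ltr_norml; lra.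
(* Moving [m] and [b] by less than [e] moves the line by less than [e * (|q.1.1| + 1)] at the centre
   of the square, which may lie outside [0, 1]. The quotient keeps this below [q.2]. *)
have e0 q : q \in L j -> 0 < q.2 / (`|q.1.1| + 2).
  by move=> qL; rewrite divr_gt0 ?(L0 j)// ltr_wpDl.
have [n1 n1P] := half_exp_le_seq (L j) _ e0.
have e'0 : 0 < (2^-1 : R) ^+ n1 by rewrite exprn_gt0.
have [J jJ [mJ bJ]] := freq _ j.+1 e'0.
(* Testing the inequality on a single interval of radius 1, which contains [0, 1], turns it into the
   upper bound [C] on the cost. *)
have [_ _ /(_ [:: (2^-1, 1)])] := mbP J; rewrite big_seq1 powR1 mulr1 => gC.
have {}gC : g J (mb J).1 (mb J).2 <= C.
  have : c + g J (mb J).1 (mb J).2 <= C.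
    apply: gC => [q|x /K01 + _].
      rewrite inE => /eqP ->/=.
      by rewrite exprn_ile1// ?invr_ge0// invf_le1// ler1n.
    rewrite /= in_itv/= => /andP[x0 x1]; exists (2^-1, 1); rewrite ?mem_head//=.
    by rewrite ltr_norml; lra.
  lra.
have L's : \sum_(q <- L') q.2 `^ (v j - 1) <= \sum_(q <- L j) h j q (mb J).1 (mb J).2.
  rewrite big_map big_filter big_mkcond/= big_seq [leRHS]big_seq.
  apply: ler_sum => q qL; rewrite /h; case: ifPn => [hq|_]; last first.
    by rewrite mulr_ge0// powR_ge0.
  suff -> : `|q.1.2 - (mb J).1 * q.1.1 - (mb J).2| < 3 * q.2 by rewrite mulr1.
  have := n1P _ (leqnn _) q qL; rewrite ler_pdivlMr ?ltr_wpDl// => e2.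
  have mx : `|(m - (mb J).1) * q.1.1| <= 2^-1 ^+ n1 * `|q.1.1|.
    by rewrite normrM ler_wpM2r// ltW.
  move: mx hq bJ e2; rewrite !ler_norml !ltr_norml mulrDr mulrBl /=; lra.
have {}L's : \sum_(q <- L') q.2 `^ (v j - 1) < Num.min eta 1.
  apply: le_lt_trans L's _; rewrite -(@ltr_pM2r _ j.+1%:R)//.
  apply: le_lt_trans Cj; rewrite mulrC; apply: le_trans gC.
  by have /andP[] := g0 J (mb J).1 (mb J).2 j jJ.
rewrite lt_min in L's; have /andP[L's1 L's2] := L's.
exists L' => //; apply: le_lt_trans L's1.
have [L'0 _] := L'F.
by apply: sum_powR_le => //; have := sv j; lra.
Qed.

(** * Localisation *)

Definition annulus {R : realType} (K : set R) (x0 d e : R) : set R :=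
  [set x | K x /\ d <= `|x - x0| <= e].

Lemma annulus_closed {R : realType} (K : set R) (x0 d e : R) :
  closed K -> closed (annulus K x0 d e).
Proof.
move=> clK; have cn : continuous (fun x : R => `|x - x0|).
  by move=> x; apply: cvg_norm; apply: cvgB; [exact: cvg_id|exact: cvg_cst].
have cl : closed ((fun x : R => `|x - x0|) @^-1` `[d, e]).
  by move/continuous_closedP: cn; apply; exact: itv_closed.
have -> : annulus K x0 d e = K `&` ((fun x : R => `|x - x0|) @^-1` `[d, e]).
  by apply/seteqP; split=> x [Kx]; rewrite /= in_itv.
exact: closedI.
Qed.

Lemma annulus_compact {R : realType} (K : set R) (x0 d e : R) :
  compact K -> compact (annulus K x0 d e).
Proof.
move=> cK; have clK : closed K by apply: compact_closed cK; exact: Rhausdorff.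
by apply: subclosed_compact (annulus_closed _ _ _ _ clK) cK _ => x [].
Qed.

Lemma within_continuous_near {R : realType} (K : set R) (f : R -> R) (x0 e : R) :
  {within K, continuous f} -> K x0 -> 0 < e ->
  exists2 d, 0 < d & forall x, K x -> `|x0 - x| < d -> `|f x0 - f x| < e.
Proof.
move=> /subspace_continuousP cf Kx0 e0.
have /nbhs_ballP[d /= d0 dP] := cf x0 Kx0 _ (nbhsx_ballx (f x0) e e0).
exists d => // x Kx xd; have := dP x; rewrite -!ball_normE /=; exact.
Qed.

Lemma null_small_ball {R : realType} {T : normedModType R} (v eta : R) : 0 < v -> 0 < eta ->
  exists2 rho, 0 < rho & forall p : T, covers [:: (p, rho)] [set x | `|p - x| < rho] /\
    \sum_(q <- [:: (p, rho)]) q.2 `^ v < eta.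
Proof.
move=> v0 eta0; exists ((eta / 2) `^ v^-1); first by rewrite powR_gt0// divr_gt0.
move=> p; split; last first.
  rewrite big_seq1 -powRrM mulVf ?gt_eqF// powRr1 ?divr_ge0 ?ltW//; lra.
split=> [q|x /= px]; last by exists (p, (eta / 2) `^ v^-1) => //; exact: mem_head.
by rewrite inE => /eqP ->/=; rewrite powR_gt0// divr_gt0.
Qed.

(** Otherwise each point of [K] has a neighbourhood whose graph is null for some exponent below [s].
    Finitely many of them cover [K], and the largest of their exponents is still below [s]. *)
Lemma exists_concentration_point {R : realType} (K : set R) (f : R -> R) (s : R) :
  compact K -> 0 < s -> (forall t, 0 < t -> t < s -> ~ null t (graph f K)) ->
  exists2 x0, K x0 & forall t e, 0 < t -> t < s -> 0 < e ->
    ~ null t (graph f (annulus K x0 0 e)).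
Proof.
move=> cK s0 nn; apply: contrapT => no.
have /choice[E EP] x : exists e, K x -> 0 < e /\
    exists t, [/\ 0 < t, t < s & null t (graph f (annulus K x 0 e))].
  have [Kx|nKx] := pselect (K x); last by exists 0.
  apply: contrapT => h; apply: no; exists x => // t e t0 ts e0 nt.
  by apply: h; exists e => _; split => //; exists t.
move: cK; rewrite compact_cover => cK.
have [| |D DK KD] := cK R K (fun x => ball x (E x)).
- by move=> x Kx; apply: ball_open; have [] := EP x Kx.
- by move=> x Kx; exists x => //; apply: ballxx; have [] := EP x Kx.
have [t [t0 ts nt]] : exists t, [/\ 0 < t, t < s & null t (graph f
    [set x | exists2 y, y \in finmap.enum_fset D & annulus K y 0 (E y) x])].
  have : forall x, x \in finmap.enum_fset D -> K x.
    by move=> x /DK; rewrite inE.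
  elim: (finmap.enum_fset D) => [_|y l IH lK].
    exists (s / 2); split; [by rewrite divr_gt0|lra|].
    apply: (sub_null _ _ set0); last exact: null_set0.
    by move=> p [x [y]]; rewrite in_nil.
  have [|t [t0 ts nt]] := IH; first by move=> x xl; apply: lK; rewrite inE xl orbT.
  have [_ [t' [t'0 t's nt']]] := EP y (lK y (mem_head _ _)).
  exists (Num.max t t'); split; [by rewrite lt_max t0|by rewrite gt_max ts|].
  apply: sub_null; last first.
    apply: null_setU (null_le t _ _ (ltW t0) _ nt) (null_le t' _ _ (ltW t'0) _ nt').
      by rewrite le_max lexx.
    by rewrite le_max lexx orbT.
  move=> _ [x [z + xz] <-]; rewrite inE => /predU1P[zy|zl].
    by right; exists x; rewrite // -zy.
  by left; exists x => //; exists z.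
apply: (nn t t0 ts); apply: sub_null nt => _ [x Kx <-]; exists x => //.
have [y yD] := KD x Kx; rewrite -ball_normE /= => xy.
exists y => //; split=> //; by rewrite normr_ge0 distrC ltW.
Qed.

(** By continuity one arbitrarily cheap ball around [(x0, f x0)] contains the graph near [x0]. If
    all annuli had null graphs, adding this ball would make the whole neighbourhood null. *)
Lemma exists_annulus {R : realType} (K : set R) (f : R -> R) (x0 t e : R) :
  {within K, continuous f} -> K x0 -> 0 < t -> 0 < e ->
  ~ null t (graph f (annulus K x0 0 e)) ->
  exists d, [/\ 0 < d, d < e & ~ null t (graph f (annulus K x0 d e))].
Proof.
move=> cf Kx0 t0 e0 nn; apply: contrapT => no; apply: nn => eta eta0.
have eta20 : 0 < eta / 2 by rewrite divr_gt0.
have [rho rho0 /(_ (x0, f x0))[[B0 Bc] Bs]] := @null_small_ball R (R * R)%type t _ t0 eta20.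
have [d1 d10 d1P] := within_continuous_near K f x0 rho cf Kx0 rho0.
pose d := Num.min (Num.min d1 rho) e / 2.
have m0 : 0 < Num.min (Num.min d1 rho) e by rewrite !lt_min d10 rho0.
have d0 : 0 < d by rewrite divr_gt0.
have [dd1 drho de] : [/\ d < d1, d < rho & d < e].
  have dm : d < Num.min (Num.min d1 rho) e by rewrite /d; lra.
  by move: dm; rewrite !lt_min => /andP[/andP[-> ->] ->].
have nd : null t (graph f (annulus K x0 d e)).
  by apply: contrapT => h; apply: no; exists d.
have [L [L0 LA] Ls] := nd _ eta20.
exists ([:: (x0, f x0, rho)] ++ L); last by rewrite big_cat/=; lra.
split=> [q|_ [x [Kx /andP[_ xe] <-]]].
  by rewrite mem_cat => /orP[/B0|/L0].
have [xd|xd] := leP d `|x - x0|.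
  have [|q qL qx] := LA (x, f x); first by exists x => //; split => //; rewrite xd.
  by exists q => //; rewrite mem_cat qL orbT.
exists (x0, f x0, rho); first by rewrite mem_cat mem_head.
rewrite prod_normE/= gt_max distrC (lt_trans xd)//= d1P//.
by rewrite distrC (lt_trans xd).
Qed.

Theorem theorem3p4 (R : realType) (K : set R) (s : R) (f : R -> R) :
  compact K -> K `<=` `[0, 1] -> 1 < s -> s <= 2 ->
  {within K, continuous f} ->
  hdim2 (graph f K) = s%:E ->
  exists F : set R,
    [/\ compact F, F `<=` K, hdim1 F = (s - 1)%:E &
        nearly_locally_lipschitz F f].
Proof.
move=> cK K01 s1 _ cf dimG.
have s0 : 0 < s by lra.
have d2ge (x y : R * R) : `|x - y| <= dist2 x y by have [] := dist2_norm x y.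
have d2le (x y : R * R) : dist2 x y <= 2 * `|x - y| by have [] := dist2_norm x y.
have nG v : s < v -> null v (graph f K).
  exact: (hdim_null (@dist2 R) d2ge (graph f K) s v (graph_compact K f cK cf) s0 dimG).
have nnG v : 0 < v -> v < s -> ~ null v (graph f K).
  exact: (hdim_not_null (@dist2 R) d2ge d2le (graph f K) s v dimG).
have [x0 Kx0 conc] := exists_concentration_point K f s cK s0 nnG.
have half0 : 0 < (2^-1 : R) by rewrite invr_gt0.
have [e0 e00 e0P] := within_continuous_near K f x0 _ cf Kx0 half0.
(* Increases strictly to [s]; the shift by 2 already gives [tau 0 > 1]. *)
pose tau n : R := s - (s - 1) / n.+2%:R.
have s10 : 0 < s - 1 by lra.
have taus n : tau n < s by rewrite /tau ltrBlDr ltrDl divr_gt0.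
have tau1 n : 1 < tau n.
  rewrite /tau ltrBrDl -ltrBrDr ltr_pdivrMr//.
  by rewrite ltr_pMr// ltr1n.
have tauS n : tau n < tau n.+1.
  rewrite /tau ltrD2l ltrN2 ltr_pM2l// ltf_pV2 ?posrE// ltr_nat//.
have tau0 n : 0 < tau n by apply: lt_trans (tau1 n).
(* The inner radius is chosen for all pairs of an outer radius and an index, with the dummy 0 when
   the radius is not positive, so that [ep] can be a plain recursion. *)
have /choice[D DP] (p : R * nat) : exists d, 0 < p.1 ->
    [/\ 0 < d, d < p.1 & ~ null (tau p.2.+1) (graph f (annulus K x0 d p.1))].
  have [p0|p0] := ltP 0 p.1; last by exists 0.
  have [d dP] := exists_annulus K f x0 _ p.1 cf Kx0 (tau0 p.2.+1) p0
    (conc _ p.1 (tau0 _) (taus _) p0).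
  by exists d.
(* Starting below [e0] keeps [f] within [2^-1] of [f x0] on every annulus. Halving the inner radius
   leaves a gap before the next annulus, and this gap later makes the slices locally isolated. *)
pose ep := fix ep n : R := if n is n'.+1 then D (ep n', n') / 2 else Num.min e0 1 / 2.
pose dl n := D (ep n, n).
have ep0 n : 0 < ep n.
  elim: n => [|n IH]; first by rewrite divr_gt0// lt_min e00/=.
  by rewrite /= divr_gt0//; have [] := DP (ep n, n) IH.
have dlP n : [/\ 0 < dl n, dl n < ep n & ~ null (tau n.+1) (graph f (annulus K x0 (dl n) (ep n)))].
  exact: (DP (ep n, n) (ep0 n)).
have epS n : ep n.+1 = dl n / 2 by [].
have ep_half n : ep n <= 2^-1 ^+ n.+1.
  elim: n => [|n IH].
    by rewrite /= expr1; have : Num.min e0 1 <= 1 by [rewrite ge_min lexx orbT]; lra.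
  by rewrite epS exprS mulrC ler_pM2l//; have [_ + _] := dlP n; lra.
have ep_dec n k : (n <= k)%N -> ep k <= ep n.
  elim: k => [|k IH]; first by rewrite leqn0 => /eqP ->.
  rewrite leq_eqVlt => /predU1P[->//|/IH]; rewrite epS.
  have [dk0 dk _] := dlP k; lra.
have dl_ep k n : (k < n)%N -> ep n <= dl k / 2 by move=> /ep_dec; rewrite epS.
have ep_e0 n : ep n < e0.
  apply: le_lt_trans (ep_dec 0%N n (leq0n n)) _ => /=.
  have : Num.min e0 1 <= e0 by rewrite ge_min lexx.
  lra.
pose A n := annulus K x0 (dl n) (ep n).
have AK n : A n `<=` K by move=> x [].
have /choice[mb mbP] n : exists mb : R * R,
    ~ null (tau n - 1) (slice (A n) f mb.1 mb.2) /\
    forall v, s - 1 < v -> null v (slice (A n) f mb.1 mb.2).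
  have cfA : {within A n, continuous f} by exact: continuous_subspaceW (AK n) cf.
  have [| | | |m [b h]] := exists_slice (A n) f (f x0) s (tau n) (tau n.+1)
    (annulus_compact K x0 _ _ cK) cfA _ _ s1 (tau1 n) (tauS n).
  - by move=> x /AK /K01.
  - move=> x [Kx /andP[_ xe]]; rewrite distrC ltW// e0P// distrC.
    exact: le_lt_trans xe (ep_e0 n).
  - by have [] := dlP n.
  - move=> v sv; apply: (sub_null v _ (graph f K)) (nG v sv).
    by move=> _ [x [Kx _] <-]; exists x.
  by exists (m, b).
pose S n := slice (A n) f (mb n).1 (mb n).2.
pose F := [set x0] `|` \bigcup_n S n.
have SF n : S n `<=` F by move=> x Sx; right; exists n.
have FK : F `<=` K by move=> x [->//|[n _ [/AK]]].
have clS n : closed (S n).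
  apply: compact_closed; first exact: Rhausdorff.
  apply: slice_compact; first exact: annulus_compact.
  exact: continuous_subspaceW (AK n) cf.
(* Away from [x0] only finitely many slices matter. This gives closedness of [F] and, with one cheap
   ball at [x0], its nullity for exponents above [s - 1]. *)
have F_split r : 0 < r -> exists N,
    F `<=` [set x | `|x - x0| <= r] `|` \bigcup_(i < N) S i.
  move=> r0; have [N NP] := half_exp_le r r0.
  exists N => x [->|[n _ Sx]]; first by left; rewrite /= subrr normr0 ltW.
  have [nN|Nn] := ltnP n N; first by right; exists n.
  left; move: Sx => [[_ /andP[_ xe]] _] /=; apply: le_trans xe _.
  apply: le_trans (ep_half n) _; by apply: NP; exact: leqW.
have clF : closed F.
  move=> x clx; have [->|xx0] := eqVneq x x0; first by left.
  have r0 : 0 < `|x - x0| / 2 by rewrite divr_gt0// normr_gt0 subr_eq0.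
  have [N NP] := F_split _ r0.
  have cl : closed ([set x1 | `|x1 - x0| <= `|x - x0| / 2] `|` \bigcup_(i < N) S i).
    apply: closedU; last first.
      by apply: closed_bigcup => //; exact: finite_II.
    have -> : [set x1 | `|x1 - x0| <= `|x - x0| / 2] =
        annulus setT x0 0 (`|x - x0| / 2).
      by apply/seteqP; split=> y /=; [move=> h; split => //; rewrite normr_ge0|case=> _ /andP[]].
    by apply: annulus_closed; exact: closedT.
  have := closure_subset NP clx; rewrite -(closure_id _).1// => -[/=|[n _ Sx]].
    have : 0 < `|x - x0| by rewrite normr_gt0 subr_eq0.
    lra.
  exact: SF Sx.
have cF : compact F by exact: subclosed_compact clF cK FK.
exists F; split => //.
- apply: (hdim_eq (@dist1 R)) => //.
  + by move=> x y; have [] := dist1_norm x y.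
  + move=> v sv eta eta0; have v0 : 0 < v by apply: lt_trans sv.
    have eta20 : 0 < eta / 2 by rewrite divr_gt0.
    have [rho rho0 /(_ x0)[B Bs]] := @null_small_ball R R v _ v0 eta20.
    have rho20 : 0 < rho / 2 by rewrite divr_gt0.
    have [N NP] := F_split _ rho20.
    have [|L LS Ls] := null_bigcup_ord v S N _ (eta / 2) eta20.
      by move=> i _; have [_] := mbP i; exact.
    have [L0 LB] := covers_cat _ _ _ _ B LS.
    exists ([:: (x0, rho)] ++ L); last by rewrite big_cat/=; lra.
    split => // x /NP[xr|Sx]; apply: LB; [left|by right].
    by rewrite /= distrC; move: xr => /=; lra.
  + move=> v v0 vs nF.
    have [n vn] : exists n, v <= tau n - 1.
      have h : 0 <= (s - 1) / (s - 1 - v) by rewrite divr_ge0// ltW// subr_gt0.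
      have /andP[_ ht] := truncn_itv h.
      exists (Num.truncn ((s - 1) / (s - 1 - v))); rewrite /tau.
      set k := Num.truncn _ in ht *.
      have : (s - 1) / k.+2%:R <= s - 1 - v.
        rewrite ler_pdivrMr// mulrC -ler_pdivrMr ?subr_gt0//.
        by apply: le_trans (ltW ht) _; rewrite ler_nat.
      by set z := _ / _; lra.
    have [+ _] := mbP n; apply; apply: (null_le v _ _ (ltW v0) vn).
    exact: sub_null (SF n) nF.
- exists [set x0]; split; first exact: countable1.
  move=> x [xe|[n _ Sx]] xx0; first by case: (xx0 xe).
  have [dl0 dlep _] := dlP n.
  (* Inner annuli stay within [dl n / 2] of [x0] and outer ones begin at distance [2 * ep n] or
     more, so near [x] the set [F] consists of its own slice, on which [f] is affine. *)
  have near y : F y -> `|x - y| < dl n / 2 -> S n y.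
    have [[_ /andP[xd xe]] _] := Sx.
    move=> [->|[k _ Sy]] xy; first by exfalso; lra.
    have [[_ /andP[yd ye]] _] := Sy.
    have h1 : `|x - x0| <= `|x - y| + `|y - x0| by exact: ler_distD.
    have h2 : `|y - x0| <= `|x - y| + `|x - x0| by rewrite (distrC x y); exact: ler_distD.
    case: (ltngtP k n) => [kn|nk|<-//]; exfalso.
      by have := dl_ep _ _ kn; lra.
    by have := dl_ep _ _ nk; lra.
  exists (dl n / 2); first by rewrite divr_gt0.
  exists `|(mb n).1| => y z Fy Fz xy xz.
  have [_ ->] := near y Fy xy; have [_ ->] := near z Fz xz.
  by rewrite opprD addrACA subrr addr0 -mulrBr normrM.
Qed.
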